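(* Let $i:Y^k\to(X^n,g)$ be an immersion with $1\le k<n$ and $n\ge3$. Then $$\mathcal K_1:=\overline\nabla^\alpha\bigl(\mathring L^{\beta\gamma\alpha'}W_{\alpha\beta\alpha'\gamma}\bigr)+(k-4)\mathring L^{\alpha\beta\alpha'}\mathcal C_{\alpha\alpha'\beta},$$ $$\mathcal K_2:=\overline\nabla^\alpha\bigl(\mathring L_\alpha{}^{\beta\alpha'}W_{\beta\gamma\alpha'}{}^\gamma\bigr)+(k-4)\mathsf D^{\alpha\alpha'}W_{\alpha\beta\alpha'}{}^\beta$$ are conformally invariant of weight $-4$.
   Context: **Curvature.** $\nabla$ is the Levi-Civita connection of $g$; $R_{abcd}$ is determined by $\nabla_a\nabla_b\tau_c-\nabla_b\nabla_a\tau_c=R_{abc}{}^d\tau_d$; $R_{ab}=R_{acb}{}^c$, $R=R_a{}^a$, $\mathsf J=\frac{R}{2(n-1)}$, $\mathsf P_{ab}=\frac1{n-2}(R_{ab}-\mathsf Jg_{ab})$, $W_{abcd}=R_{abcd}-\mathsf P_{ac}g_{bd}-\mathsf P_{bd}g_{ac}+\mathsf P_{ad}g_{bc}+\mathsf P_{bc}g_{ad}$, $C_{abc}=\nabla_a\mathsf P_{bc}-\nabla_b\mathsf P_{ac}$. **Submanifold.** $i^*TX=TY\oplus NY$ ($g$-orthogonal); abstract indices $\alpha,\beta,\gamma,\dots$ denote projection to $TY$, primed indices $\alpha',\beta',\dots$ projection to $NY$, Latin indices label $i^*TX$; indices are raised and lowered with $g$. $\overline\nabla$ is the connection on $TY$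 and $NY$ obtained by projecting $\nabla$. $L(U,V)=(\nabla_UV)^\perp$ is the second fundamental form $L_{\alpha\beta\alpha'}$, $H_{\alpha'}=\frac1kL_\alpha{}^\alpha{}_{\alpha'}$, $\mathring L_{\alpha\beta\alpha'}=L_{\alpha\beta\alpha'}-H_{\alpha'}g_{\alpha\beta}$. Further, $\mathsf D_{\alpha\alpha'}=\mathsf P_{\alpha\alpha'}-\overline\nabla_\alpha H_{\alpha'}$ and $\mathcal C_{abc}=C_{abc}-H^{\alpha'}W_{abc\alpha'}$. A scalar $T$, assigning to each immersion $i:Y^k\to(X^n,g)$ a function $T^g$ on $Y$, is conformally invariant of weight $w$ if $T^{e^{2\Upsilon}g}=e^{w\,i^*\Upsilon}T^g$ for all immersions and all $\Upsilon\in C^\infty(X)$. *)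

(* Defs.v *)
From HB Require Import structures.
From mathcomp Require Import all_boot all_order all_algebra.
From mathcomp Require Import all_classical all_reals all_analysis.
From mathcomp Require Import ring.
Set Implicit Arguments.
Unset Strict Implicit.
Unset Printing Implicit Defensive.
Import Order.TTheory GRing.Theory Num.Theory.
Import numFieldNormedType.Exports.
Local Open Scope classical_set_scope.
Local Open Scope ring_scope.

Section SmoothFunctions.
Variable R : realType.

Definition pd n (i : 'I_n) (u : 'rV[R]_n -> R) (x : 'rV[R]_n) : R :=
  'D_('e_i) u x.

(* C^oo on U, which is open wherever this is used. *)
Definition smooth_on n (U : set 'rV[R]_n) (u : 'rV[R]_n -> R) : Prop :=
  forall (s : seq 'I_n) (x : 'rV[R]_n), U x ->
    differentiable (foldr (@pd n) u s) x.

Definition smooth_map_on n m (U : set 'rV[R]_n) (F : 'rV[R]_n -> 'rV[R]_m)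
  : Prop := forall j : 'I_m, smooth_on U (fun x => F x 0 j).

End SmoothFunctions.

Section Manifolds.
Variable R : realType.

(* [chart_map] and [chart_inv] are total functions; they are mutually inverse
   homeomorphisms between [chart_dom] and its image [chart_img] only, and their
   values elsewhere are irrelevant. *)
Record chart (M : topologicalType) n := Chart {
  chart_dom : set M;
  chart_map :> M -> 'rV[R]_n;
  chart_inv : 'rV[R]_n -> M }.

Definition chart_img (M : topologicalType) n (c : chart M n) : set 'rV[R]_n :=
  c @` chart_dom c.

Definition is_chart (M : topologicalType) n (c : chart M n) : Prop :=
  [/\ open (chart_dom c), open (chart_img c),
      {within chart_dom c, continuous c},
      {within chart_img c, continuous (chart_inv c)} &
      forall p, chart_dom c p -> chart_inv c (c p) = p].

Record manifold n := Manifold {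
  mcarrier :> topologicalType;
  atlas : set (chart mcarrier n);
  manifold_hausdorff : hausdorff_space mcarrier;
  manifold_second_countable : @second_countable mcarrier;
  manifold_charts : forall c, atlas c -> is_chart c;
  manifold_cover : forall p, exists2 c, atlas c & chart_dom c p;
  manifold_compatible : forall c c', atlas c -> atlas c' ->
    smooth_map_on (chart_img c `&` chart_inv c @^-1` chart_dom c')
                  (c' \o chart_inv c) }.

Definition smooth_fun n (X : manifold n) (u : X -> R) : Prop :=
  forall c, atlas c -> smooth_on (chart_img c) (u \o chart_inv c).

Definition coord_rep k n (Y : manifold k) (X : manifold n) (i : Y -> X)
    (cY : chart Y k) (cX : chart X n) : 'rV[R]_k -> 'rV[R]_n :=
  cX \o i \o chart_inv cY.

Definition smooth_mfd_map k n (Y : manifold k) (X : manifold n) (i : Y -> X)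
  : Prop :=
  continuous i /\
  forall (cY : chart Y k) (cX : chart X n), atlas cY -> atlas cX ->
    smooth_map_on (chart_img cY `&` (i \o chart_inv cY) @^-1` chart_dom cX)
                  (coord_rep i cY cX).

(* 'J is a k x n matrix whose rows are the images of the coordinate vectors,
   so [row_free] says that the differential is injective. *)
Definition immersion k n (Y : manifold k) (X : manifold n) (i : Y -> X)
  : Prop :=
  smooth_mfd_map i /\
  forall (p : Y) (cY : chart Y k) (cX : chart X n), atlas cY -> atlas cX ->
    chart_dom cY p -> chart_dom cX (i p) ->
    row_free ('J (coord_rep i cY cX) (cY p)).

(* A metric is given by its component matrices in the charts of the atlas. *)
Definition metric_field n (X : manifold n) :=
  chart X n -> 'rV[R]_n -> 'M[R]_n.

Definition riemannian n (X : manifold n) (g : metric_field X) : Prop :=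
  forall c, atlas c ->
    (forall a b, smooth_on (chart_img c) (fun x => g c x a b)) /\
    forall x, chart_img c x ->
      [/\ (g c x)^T = g c x,
          forall v : 'rV[R]_n, v != 0 -> 0 < (v *m g c x *m v^T) 0 0 &
          forall c', atlas c' -> chart_dom c' (chart_inv c x) ->
            let J := 'J (c' \o chart_inv c) x in
            g c x = J *m g c' (c' (chart_inv c x)) *m J^T].

(* e^{2 Ups} g *)
Definition conformal_change n (X : manifold n) (Ups : X -> R)
    (g : metric_field X) : metric_field X :=
  fun c x => expR (2 * Ups (chart_inv c x)) *: g c x.

End Manifolds.

(* Components of the tensors of (U, g), U open in R^n, in coordinate indices.
   All indices are lower ones unless the comment says otherwise. *)
Section AmbientCurvature.
Variables (R : realType) (n : nat) (g : 'rV[R]_n -> 'M[R]_n).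
Implicit Types (x : 'rV[R]_n) (a b c d e : 'I_n).

Definition gup x : 'M[R]_n := invmx (g x).

(* Gamma^c_{ab} *)
Definition christoffel c a b x : R :=
  2^-1 * \sum_d gup x c d *
    (pd a (fun z => g z b d) x + pd b (fun z => g z a d) x
     - pd d (fun z => g z a b) x).

(* nabla_a tau_b *)
Definition nabla1 (tau : 'I_n -> 'rV[R]_n -> R) a b x : R :=
  pd a (tau b) x - \sum_d christoffel d a b x * tau d x.

(* nabla_a T_{bc} *)
Definition nabla2 (T : 'I_n -> 'I_n -> 'rV[R]_n -> R) a b c x : R :=
  pd a (T b c) x - \sum_d christoffel d a b x * T d c x
                 - \sum_d christoffel d a c x * T b d x.

(* R_{abc}^d, read off from
   nabla_a nabla_b tau_c - nabla_b nabla_a tau_c = R_{abc}^d tau_d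
   by taking for tau the coordinate one-form dx^d. *)
Definition riemann a b c d x : R :=
  let dxd := fun (e : 'I_n) (_ : 'rV[R]_n) => (e == d)%:R : R in
  nabla2 (nabla1 dxd) a b c x - nabla2 (nabla1 dxd) b a c x.

(* R_{abcd} = g_{de} R_{abc}^e *)
Definition riemann_low a b c d x : R := \sum_e g x d e * riemann a b c e x.

Definition ricci a b x : R := \sum_c riemann a c b c x.

Definition scalar_curv x : R := \sum_a \sum_b gup x a b * ricci a b x.

Definition schoutenJ x : R := scalar_curv x / (2 * (n%:R - 1)).

Definition schouten a b x : R :=
  (ricci a b x - schoutenJ x * g x a b) / (n%:R - 2).

Definition weyl a b c d x : R :=
  riemann_low a b c d x - schouten a c x * g x b d - schouten b d x * g x a c
  + schouten a d x * g x b c + schouten b c x * g x a d.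

Definition cotton a b c x : R := nabla2 schouten a b c x - nabla2 schouten b a c x.

Lemma christoffel_torsion_free c a b x :
  (forall z, (g z)^T = g z) -> christoffel c a b x = christoffel c b a x.
Proof.
move=> gT; rewrite /christoffel; congr (_ * _); apply: eq_bigr => d _.
congr (_ * (_ - _)); first exact: addrC.
by congr (pd d _ x); apply/funext => z; rewrite -{1}gT mxE.
Qed.

Lemma christoffel_metric a b c x :
  (forall z, (g z)^T = g z) -> g x \in unitmx ->
  nabla2 (fun d e z => g z d e) a b c x = 0.
Proof.
move=> gT gx.
have gC z i j : g z i j = g z j i by rewrite -{1}gT mxE.
have gpd m i j : pd m (fun z => g z i j) = pd m (fun z => g z j i).
  by congr (pd m); apply/funext => z; rewrite gC.
have low i j : \sum_d christoffel d a i x * g x d j =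
  2^-1 * (pd a (fun z => g z i j) x + pd i (fun z => g z a j) x
          - pd j (fun z => g z a i) x).
  set G := fun e => pd a (fun z => g z i e) x + pd i (fun z => g z a e) x
                    - pd e (fun z => g z a i) x.
  have -> : \sum_d christoffel d a i x * g x d j =
            2^-1 * \sum_e (\sum_d g x j d * gup x d e) * G e.
    rewrite [in RHS]mulr_sumr.
    under [RHS]eq_bigr => e _ do rewrite mulr_suml mulr_sumr.
    rewrite exchange_big /=; apply: eq_bigr => d _.
    rewrite /christoffel mulr_sumr mulr_suml; apply: eq_bigr => e _.
    by rewrite (gC x d j) -/(G e); ring.
  congr (_ * _); rewrite (bigD1 j) //= [X in _ + X]big1 => [|e ej].
    by have /matrixP/(_ j j) := mulmxV gx; rewrite !mxE eqxx => ->; rewrite mul1r addr0.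
  have /matrixP/(_ j e) := mulmxV gx; rewrite !mxE eq_sym (negPf ej) => ->.
  by rewrite mul0r.
have low' : \sum_d christoffel d a c x * g x b d =
            \sum_d christoffel d a c x * g x d b.
  by apply: eq_bigr => d _; rewrite gC.
by rewrite /nabla2 low' !low (gpd a c b) (gpd b a c) (gpd c a b); field.
Qed.

End AmbientCurvature.

(* Components along y |-> f y, f an immersion of an open set of R^k into
   (U, g).  Tangential indices p, q, r, s are coordinate indices of R^k; a
   normal index is an index c : 'I_n of i^*TX (upper) or i^*T^*X (lower) in
   which the tensor is fixed by the orthogonal projection to NY. *)
Section Submanifold.
Variables (R : realType) (k n : nat).
Variables (g : 'rV[R]_n -> 'M[R]_n) (f : 'rV[R]_k -> 'rV[R]_n).
Implicit Types (y : 'rV[R]_k) (p q r s : 'I_k) (a b c d e : 'I_n).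

(* the coordinate vector field d_p of Y, as a section of i^*TX *)
Definition tvec p a y : R := pd p (fun z => f z 0 a) y.

Definition first_form y : 'M[R]_k :=
  \matrix_(p, q) \sum_a \sum_b g (f y) a b * tvec p a y * tvec q b y.

Definition hup y : 'M[R]_k := invmx (first_form y).

(* V^top = \sum_r tan_coef V r d_r *)
Definition tan_coef (V : 'I_n -> 'rV[R]_k -> R) r y : R :=
  \sum_q hup y r q * \sum_a \sum_b g (f y) a b * tvec q a y * V b y.

Definition perp (V : 'I_n -> 'rV[R]_k -> R) c y : R :=
  V c y - \sum_r tan_coef V r y * tvec r c y.

(* projection of the c-th coordinate vector to NY; contracting a lower index
   with [nor c] projects it to N^*Y and names the resulting index c *)
Definition nor c a y : R := perp (fun b _ => (b == c)%:R) a y.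

(* (nabla_{d_p} V)^c, V a section of i^*TX *)
Definition nabla_pull p (V : 'I_n -> 'rV[R]_k -> R) c y : R :=
  pd p (V c) y + \sum_a \sum_b christoffel g c a b (f y) * tvec p a y * V b y.

(* connection coefficients of nabla-bar on TY:
   (nabla_{d_p} d_q)^top = \sum_r nablabar_coef r p q d_r *)
Definition nablabar_coef r p q y : R := tan_coef (nabla_pull p (tvec q)) r y.

(* nabla-bar_p S_q, S a section of T^*Y *)
Definition nablabar_cotan (S : 'I_k -> 'rV[R]_k -> R) p q y : R :=
  pd p (S q) y - \sum_r nablabar_coef r p q y * S r y.

(* nabla-bar^p S_p *)
Definition nablabar_div (S : 'I_k -> 'rV[R]_k -> R) y : R :=
  \sum_p \sum_q hup y p q * nablabar_cotan S p q y.

(* (nabla-bar_p V)^c, V a section of NY *)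
Definition nablabar_normal p (V : 'I_n -> 'rV[R]_k -> R) c y : R :=
  perp (nabla_pull p V) c y.

(* L_{pq}^c *)
Definition second_form p q c y : R := perp (nabla_pull p (tvec q)) c y.

(* H^c *)
Definition mean_curv c y : R :=
  k%:R^-1 * \sum_p \sum_q hup y p q * second_form p q c y.

(* Lo_{pq}^c *)
Definition Lo p q c y : R :=
  second_form p q c y - first_form y p q * mean_curv c y.

(* Lo_p^{qc} *)
Definition Lo_up1 p q c y : R := \sum_s hup y q s * Lo p s c y.

(* Lo^{pqc} *)
Definition Lo_up2 p q c y : R := \sum_s hup y p s * Lo_up1 s q c y.

(* W_{pqcr}, c normal *)
Definition weylY p q c r y : R :=
  \sum_a \sum_b \sum_d \sum_e
    weyl g a b d e (f y) * tvec p a y * tvec q b y * nor c d y * tvec r e y.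

(* W_{pqc}^q, c normal and the trace over TY *)
Definition weylY_tr p c y : R :=
  \sum_q \sum_r hup y q r * weylY p q c r y.

(* D_{pc} = P_{pc} - nabla-bar_p H_c, c normal *)
Definition tensorD p c y : R :=
  \sum_a \sum_b schouten g a b (f y) * tvec p a y * nor c b y
  - \sum_d g (f y) c d * nablabar_normal p mean_curv d y.

(* C_{abc} - H^{d} W_{abcd} *)
Definition calC a b c y : R :=
  cotton g a b c (f y) - \sum_d mean_curv d y * weyl g a b c d (f y).

(* the components of the previous tensor with a, c tangential, b normal *)
Definition calCY p c q y : R :=
  \sum_a \sum_b \sum_d calC a b d y * tvec p a y * nor c b y * tvec q d y.

Definition K1 y : R :=
  nablabar_div (fun p z => \sum_q \sum_r \sum_c
                             Lo_up2 q r c z * weylY p q c r z) y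
  + (k%:R - 4) * \sum_p \sum_q \sum_c Lo_up2 p q c y * calCY p c q y.

Definition K2 y : R :=
  nablabar_div (fun p z => \sum_q \sum_c Lo_up1 p q c z * weylY_tr q c z) y
  + (k%:R - 4) * \sum_p \sum_q \sum_c \sum_d
      hup y p q * gup g (f y) c d * tensorD p c y * weylY_tr q d y.

End Submanifold.

(* A scalar T is given by its expression in local coordinates: [T g f y] is its
   value at the point of coordinates y for the metric with components g and the
   immersion with coordinate representation f.  Conformal invariance is required
   in every chart of Y around p and every chart of X around i p. *)
Definition local_scalar (R : realType) (k n : nat) :=
  ('rV[R]_n -> 'M[R]_n) -> ('rV[R]_k -> 'rV[R]_n) -> 'rV[R]_k -> R.

Definition scalar_at (R : realType) k n (T : local_scalar R k n)
    (Y : manifold R k) (X : manifold R n) (i : Y -> X) (g : metric_field X)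
    (cY : chart R Y k) (cX : chart R X n) (p : Y) : R :=
  T (g cX) (coord_rep i cY cX) (cY p).

Definition conformally_invariant (R : realType) k n (T : local_scalar R k n)
    (w : R) : Prop :=
  forall (Y : manifold R k) (X : manifold R n) (i : Y -> X)
    (g : metric_field X) (Ups : X -> R),
    immersion i -> riemannian g -> smooth_fun Ups ->
    forall (p : Y) (cY : chart R Y k) (cX : chart R X n),
      atlas cY -> atlas cX -> chart_dom cY p -> chart_dom cX (i p) ->
      scalar_at T i (conformal_change Ups g) cY cX p =
      expR (w * Ups (i p)) * scalar_at T i g cY cX p.

(* Main.v *)
Require Import Defs.
From HB Require Import structures.
From mathcomp Require Import all_boot all_order all_algebra.
From mathcomp Require Import all_classical all_reals all_analysis.
From mathcomp Require Import ring.
Set Implicit Arguments.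
Unset Strict Implicit.
Unset Printing Implicit Defensive.
Import Order.TTheory GRing.Theory Num.Theory.
Import numFieldNormedType.Exports.
Local Open Scope classical_set_scope.
Local Open Scope ring_scope.

(** In the coordinates of a pair of charts the change of metric is
    [e^(2u) g], and every ingredient of K1 and K2 transforms explicitly.  With
    [Q = - nabla du + du du - |du|^2 g / 2], the Schouten tensor becomes [P + Q],
    [W_abcd] is rescaled by [e^(2u)], and [C_abc] becomes [C_abc - W_abc^d u_d];
    the trace-free second fundamental form [Lo_pq^c] is invariant, the mean
    curvature vector becomes [e^(-2u) (H - (grad u)^perp)], so that [calC_abc]
    changes by [- u^r W_abcr] and [D_pc] by [- u^r Lo_prc] with [r] tangential.
    The divergences in K1 and K2 are those of one-forms S of weight -2 on a
    k-manifold, hence pick up [(k - 4) u^p S_p].  By the pair symmetry of W and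
    the symmetry of Lo this is exactly cancelled by the second terms. *)

(** * Partial derivatives and smooth functions *)

(** A divergence along Y produces only tangential derivatives of u. The normal gradient in the
    change of the Cotton tensor and the mixed Hessian in the change of the Schouten tensor must
    therefore disappear on their own. The mean curvature terms of [calC] and [tensorD] achieve this:
    up to scale, H changes by minus the normal gradient. Differentiating the normal gradient rather
    than the full one leaves [u^r L_prc], and a term [u_p H_c], due to the scale of H and the change
    of connection, turns L into its trace-free part.

    Symmetry and invertibility of g are known only on the image of a chart. Identities are therefore
    proved at the points of open sets [U] and [V], and moved under a derivative by [pd_ext]. No
    normal coordinates are used: Christoffel symbols stay in the formulas until they cancel, and
    contracted sums are isolated so that a polynomial identity remains. Pair symmetry of the
    curvature rests on commuting second derivatives of g, hence on Schwarz's theorem for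
    [smooth_on]. *)

Lemma near_eq_differentiable (R : realType) (V W : normedModType R)
    (f g : V -> W) (x : V) :
  {near x, f =1 g} -> differentiable f x -> differentiable g x.
Proof.
move=> fg df; have fgx : f x = g x by exact: nbhs_singleton fg.
(* The differential of [f] gives a first-order expansion of [g] as well, and a continuous linear map
   with this property is unique. *)
have gE : g \o shift x = cst (g x) + 'd f x +o_ 0 id.
  apply/eqaddoP => e e0.
  have /eqaddoP/(_ e e0) := diff_locally df.
  have : \forall h \near (0 : V), f (h + x) = g (h + x).
    have : \forall z \near x, f z = g z by exact: fg.
    by rewrite (near_shift 0); apply: filterS => h /=; rewrite subr0.
  apply: filterS2 => h /= fgh; rewrite !fctE /= -fgx.
  by rewrite fgh.
have dg : 'd g x = 'd f x :> (V -> W).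
  by apply: diff_unique => //; exact: diff_continuous.
by apply/diff_locallyP; rewrite dg; split => //; exact: diff_continuous.
Qed.

Section Pd.
Variables (R : realType) (n : nat).
Implicit Types (U : set 'rV[R]_n) (f g : 'rV[R]_n -> R) (x : 'rV[R]_n) (i j : 'I_n).

Lemma pd_ext U f g x i : open U -> U x -> (forall z, U z -> f z = g z) ->
  pd i f x = pd i g x.
Proof.
move=> oU Ux fg; apply: near_eq_derive.
have : nbhs x U by exact: open_nbhs_nbhs.
by apply: filterS => z /fg.
Qed.

Lemma differentiable_ext U f g x : open U -> U x ->
  (forall z, U z -> f z = g z) -> differentiable f x -> differentiable g x.
Proof.
move=> oU Ux fg; apply: near_eq_differentiable.
have : nbhs x U by exact: open_nbhs_nbhs.
by apply: filterS => z /fg.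
Qed.

Lemma pd_cst (c : R) i x : pd i (fun=> c) x = 0.
Proof. exact: derive_cst. Qed.

Lemma pdD f g i x : differentiable f x -> differentiable g x ->
  pd i (fun z => f z + g z) x = pd i f x + pd i g x.
Proof.
move=> df dg.
by rewrite /pd -deriveD //; exact: diff_derivable.
Qed.

Lemma pdN f i x : differentiable f x ->
  pd i (fun z => - f z) x = - pd i f x.
Proof.
move=> df.
by rewrite /pd -deriveN //; exact: diff_derivable.
Qed.

Lemma pdB f g i x : differentiable f x -> differentiable g x ->
  pd i (fun z => f z - g z) x = pd i f x - pd i g x.
Proof.
move=> df dg.
by rewrite /pd -deriveB //; exact: diff_derivable.
Qed.

Lemma pdM f g i x : differentiable f x -> differentiable g x ->
  pd i (fun z => f z * g z) x = pd i f x * g x + f x * pd i g x.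
Proof.
move=> df dg.
have := @deriveM _ _ f g x 'e_i (diff_derivable df) (diff_derivable dg).
by rewrite /pd => ->; rewrite /GRing.scale /=; ring.
Qed.

Lemma diff_pd_sum (I : Type) (s : seq I) (P : pred I) (F : I -> 'rV[R]_n -> R) i x :
  (forall k, P k -> differentiable (F k) x) ->
  differentiable (fun z => \sum_(k <- s | P k) F k z) x /\
  pd i (fun z => \sum_(k <- s | P k) F k z) x = \sum_(k <- s | P k) pd i (F k) x.
Proof.
move=> dF; elim: s => [|a s [ds IH]].
  rewrite (_ : (fun z => _) = cst 0); last first.
    by apply/funext => z; rewrite big_nil.
  by split; [exact: differentiable_cst | rewrite big_nil; exact: pd_cst].
rewrite big_cons; case: ifPn => Pa; last first.
  rewrite (_ : (fun z => _) = (fun z => \sum_(k <- s | P k) F k z)) //.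
  by apply/funext => z; rewrite big_cons (negPf Pa).
rewrite (_ : (fun z => _) = (fun z => F a z + \sum_(k <- s | P k) F k z)); last first.
  by apply/funext => z; rewrite big_cons Pa.
split; last by rewrite pdD ?IH//; exact: dF.
by apply: differentiableD => //; exact: dF.
Qed.

Lemma pd_sum (I : Type) (s : seq I) (P : pred I) (F : I -> 'rV[R]_n -> R) i x :
  (forall k, P k -> differentiable (F k) x) ->
  pd i (fun z => \sum_(k <- s | P k) F k z) x = \sum_(k <- s | P k) pd i (F k) x.
Proof. by move=> dF; have [] := diff_pd_sum s i dF. Qed.

Lemma pdV f i x : differentiable f x -> f x != 0 ->
  pd i (fun z => (f z)^-1) x = - ((f x)^-1 * (f x)^-1 * pd i f x).
Proof.
move=> df f0; rewrite /pd.
rewrite deriveE; last exact: differentiableV.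
by rewrite diffV // deriveE //= /GRing.scale /= -expr2 exprVn mulNr.
Qed.

Lemma differentiable_expR f x : differentiable f x ->
  differentiable (fun z => expR (f z)) x.
Proof.
move=> df; apply: (@differentiable_comp _ _ _ _ f (expR : R -> R)) => //.
by apply/derivable1_diffP; exact: derivable_expR.
Qed.

Lemma pd_expR f i x : differentiable f x ->
  pd i (fun z => expR (f z)) x = expR (f x) * pd i f x.
Proof.
move=> df; have de : differentiable (expR : R -> R) (f x).
  by apply/derivable1_diffP; exact: derivable_expR.
rewrite /pd deriveE; last exact: differentiable_expR.
rewrite (@diff_comp _ _ _ _ f (expR : R -> R)) //= -(@deriveE _ _ _ f) //.
set w := 'D_'e_i f x.
have -> : 'd (expR : R -> R) (f x) w = w * 'd (expR : R -> R) (f x) 1.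
  by rewrite -[in LHS](mulr1 w) linearZ.
by rewrite -deriveE // derive_val mulrC.
Qed.

Lemma MVT_dir f x (v : 'rV[R]_n) (h : R) : 0 < h ->
  (forall s, 0 <= s <= h -> differentiable f (x + s *: v)) ->
  exists2 c, 0 <= c <= h &
    f (x + h *: v) - f x = h * 'D_v f (x + c *: v).
Proof.
move=> h0 df.
(* The difference quotients of [f] along [v] and those of its restriction to the line are the same
   function of the increment, so the one-variable mean value theorem applies. *)
have shE s : (fun t : R => t^-1 *:
     (((f \o (fun s => x + s *: v)) \o shift s) (t *: 1) - f (x + s *: v)))
   = (fun t => t^-1 *: ((f \o shift (x + s *: v)) (t *: v) - f (x + s *: v))).
  apply/funext => t /=; congr (_ *: (f _ - _)).
  by rewrite scalerDl [t *: 1]mulr1 addrCA.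
have dphi s : 0 <= s <= h ->
    is_derive s 1 (f \o (fun s => x + s *: v)) ('D_v f (x + s *: v)).
  move=> /df /(@diff_derivable _ _ _ _ _ v) dfs; split.
    by rewrite /derivable shE.
  by rewrite /derive shE.
have [||c] := @MVT_segment R (f \o (fun s => x + s *: v))
    (fun s => 'D_v f (x + s *: v)) 0 h (ltW h0).
- move=> s; rewrite in_itv /= => /andP[s0 sh]; apply: dphi.
  by rewrite !ltW.
- apply: derivable_within_continuous => s; rewrite in_itv /= => sh.
  by have [] := dphi s sh.
rewrite in_itv /= => c0h; rewrite scale0r addr0 subr0 => E.
by exists c => //; rewrite E mulrC.
Qed.

(* The mean value theorem in direction i, then in direction j. *)
Lemma second_difference U f x i j (h : R) : 0 < h ->
  (forall s t, 0 <= s <= h -> 0 <= t <= h -> U (x + s *: 'e_i + t *: 'e_j)) ->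
  (forall z, U z -> differentiable f z) ->
  (forall z, U z -> differentiable (pd i f) z) ->
  exists s t, [/\ 0 <= s <= h, 0 <= t <= h &
    f (x + h *: 'e_i + h *: 'e_j) - f (x + h *: 'e_i)
    - (f (x + h *: 'e_j) - f x) = h * (h * pd j (pd i f) (x + s *: 'e_i + t *: 'e_j))].
Proof.
move=> h0 hU df ddf.
have hh : 0 <= h <= h by rewrite ltW /=.
have h00 : 0 <= (0 : R) <= h by rewrite lexx ltW.
pose F z := f (z + h *: 'e_j) - f z.
have shD v s : 0 <= s <= h -> U (x + s *: 'e_i + v) ->
    differentiable (fun z : 'rV[R]_n => f (z + v)) (x + s *: 'e_i).
  move=> sh Uv; apply: (@differentiable_comp _ _ _ _ (fun z => z + v) f); last exact: df.
  exact: (@differentiableD _ _ _ id (cst v)).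
have shE v z : 'D_'e_i (fun z : 'rV[R]_n => f (z + v)) z = pd i f (z + v).
  rewrite /pd /derive; set D1 := fun h => _; set D2 := fun h => _.
  by suff -> : D1 = D2 by []; apply/funext => t; rewrite /D1 /D2 /= addrA.
have dF1 s : 0 <= s <= h -> differentiable (fun z => f (z + h *: 'e_j)) (x + s *: 'e_i).
  by move=> sh; apply: shD => //; exact: hU.
have dF2 s : 0 <= s <= h -> differentiable f (x + s *: 'e_i).
  move=> sh; apply: df; have := hU s 0 sh h00; by rewrite scale0r addr0.
have [s sh Es] : exists2 s, 0 <= s <= h & F (x + h *: 'e_i) - F x = h * 'D_'e_i F (x + s *: 'e_i).
  apply: MVT_dir => // s sh; apply: differentiableB; [exact: dF1|exact: dF2].
have FE : 'D_'e_i F (x + s *: 'e_i) = pd i f (x + s *: 'e_i + h *: 'e_j) - pd i f (x + s *: 'e_i).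
  rewrite /F (@deriveB _ _ _ (fun z => f (z + h *: 'e_j)) f); last 2 first.
  - exact/diff_derivable/dF1.
  - exact/diff_derivable/dF2.
  by rewrite shE.
have [t th Et] : exists2 t, 0 <= t <= h &
    pd i f (x + s *: 'e_i + h *: 'e_j) - pd i f (x + s *: 'e_i) =
    h * pd j (pd i f) (x + s *: 'e_i + t *: 'e_j).
  by apply: MVT_dir => // t th; apply: ddf; exact: hU.
exists s, t; split => //; by rewrite -Et -FE -Es.
Qed.

(** Schwarz's theorem: the second difference over a small square is [h^2] times a nearby value of
    either mixed derivative, so by continuity the two cannot differ at [x]. *)
Lemma pd_comm U f x i j : open U -> U x ->
  (forall z, U z -> differentiable f z) ->
  (forall k z, U z -> differentiable (pd k f) z) ->
  (forall k l, {for x, continuous (pd k (pd l f))}) ->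
  pd i (pd j f) x = pd j (pd i f) x.
Proof.
move=> oU Ux df ddf cf; apply/eqP; apply/negPn/negP => neq.
have tri (a b c d : R) : `|b - c| < d -> `|a - c| < d -> `|b - a| < d + d.
  move=> bc ac; rewrite (_ : b - a = (b - c) - (a - c)); last by ring.
  by rewrite (le_lt_trans (ler_normB _ _)) // ltrD.
pose A := pd j (pd i f); pose B := pd i (pd j f).
(* Half the gap: a common value within [e] of both [A x] and [B x] would put them at distance less
   than [e + e], the gap itself. *)
pose e := `|B x - A x| / 2.
have e0 : 0 < e by rewrite divr_gt0 // normr_gt0 subr_eq0.
have /nbhs_normP[r /= r0 hr] : nbhs x
    ([set z | `|A x - A z| < e] `&` [set z | `|B x - B z| < e] `&` U).
  apply: filterI; last exact: open_nbhs_nbhs.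
  apply: filterI.
    by have /cvgrPdist_lt/(_ e e0) := cf j i.
  by have /cvgrPdist_lt/(_ e e0) := cf i j.
(* A displacement inside the square has norm at most [h] times the sum of the two norms; the extra 1
   makes the bound by [h * N] strict and [N] positive. *)
pose N : R := `|'e_i : 'rV[R]_n| + `|'e_j : 'rV[R]_n| + 1.
have N0 : 0 < N by rewrite ltr_wpDl // addr_ge0.
have [h h0 hN] : exists2 h, 0 < h & h * N <= r.
  exists (r / 2 / N); first by rewrite !divr_gt0.
  by rewrite divfK ?gt_eqF // ler_pdivrMr // ler_peMr ?ltW // ltrDl.
have inb s t : 0 <= s <= h -> 0 <= t <= h -> `|x - (x + s *: 'e_i + t *: 'e_j)| < r.
  move=> /andP[s0 sh] /andP[t0 th].
  rewrite -addrA opprD addNKr normrN (le_lt_trans (ler_normD _ _)) // !normrZ.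
  rewrite (ger0_norm s0) (ger0_norm t0).
  apply: (@le_lt_trans _ _ (h * `|'e_i : 'rV[R]_n| + h * `|'e_j : 'rV[R]_n|)).
    by rewrite lerD // ler_wpM2r.
  by rewrite -mulrDr (lt_le_trans _ hN) // ltr_pM2l // ltrDl.
have inb' s t : 0 <= s <= h -> 0 <= t <= h -> `|x - (x + s *: 'e_j + t *: 'e_i)| < r.
  by move=> sh th; rewrite -addrA (addrC (s *: _)) addrA; exact: inb.
have [s [t [sh th E1]]] := @second_difference U f x i j h h0
  (fun s t sh th => (hr _ (inb s t sh th)).2) df (ddf i).
have [s' [t' [sh' th' E2]]] := @second_difference U f x j i h h0
  (fun s t sh th => (hr _ (inb' s t sh th)).2) df (ddf j).
(* The second difference does not depend on the order of the two directions, so the two mean values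
   coincide. *)
have AB : A (x + s *: 'e_i + t *: 'e_j) = B (x + s' *: 'e_j + t' *: 'e_i).
  have key (a b c d p q : R) : a - b - (c - d) = h * (h * p) ->
      a - c - (b - d) = h * (h * q) -> p = q.
    move=> e1 e2; apply: (mulfI (lt0r_neq0 h0)); apply: (mulfI (lt0r_neq0 h0)).
    by rewrite -e1 -e2; ring.
  rewrite (addrAC x (h *: 'e_j)) in E2; exact: key E1 E2.
clear E1 E2; have [[/= hA _] _] := hr _ (inb _ _ sh th).
have [[/= _ hB] _] := hr _ (inb' _ _ sh' th').
move: hA; rewrite AB; set w := B _ in hB * => hA.
have := tri _ _ _ _ hB hA.
by rewrite /e -splitr ltxx.
Qed.

End Pd.

(** * The chain rule for maps between coordinate spaces *)

Section ChainRule.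
Variables (R : realType) (k n : nat).
Implicit Types (F : 'rV[R]_k -> 'rV[R]_n) (f : 'rV[R]_n -> R) (x : 'rV[R]_k).

Lemma differentiable_rV F x :
  (forall a, differentiable (fun z => F z 0 a) x) -> differentiable F x.
Proof.
move=> dF; have -> : F = \sum_a (fun z => F z 0 a *: ('e_a : 'rV[R]_n)).
  by apply/funext => z; rewrite fct_sumE -row_sum_delta.
by apply: differentiable_sum => a; exact: differentiableZl.
Qed.

Lemma derive_rV F x p : (forall a, differentiable (fun z => F z 0 a) x) ->
  'D_('e_p) F x = \row_a pd p (fun z => F z 0 a) x.
Proof.
move=> dF; rewrite derive_mx; first by apply/rowP => a; rewrite !mxE.
exact/diff_derivable/differentiable_rV.
Qed.

Lemma jacobian_pd F x p a : (forall a, differentiable (fun z => F z 0 a) x) ->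
  'J F x p a = pd p (fun z => F z 0 a) x.
Proof.
move=> dF; have := deriveEjacobian 'e_p (differentiable_rV dF).
by rewrite derive_rV // -rowE => /rowP/(_ a); rewrite !mxE.
Qed.

Lemma differentiable_comp_rV f F x : differentiable f (F x) ->
  (forall a, differentiable (fun z => F z 0 a) x) ->
  differentiable (fun z => f (F z)) x.
Proof.
by move=> df dF; apply: differentiable_comp => //; exact: differentiable_rV.
Qed.

Lemma pd_comp f F x p : differentiable f (F x) ->
  (forall a, differentiable (fun z => F z 0 a) x) ->
  pd p (fun z => f (F z)) x = \sum_a pd p (fun z => F z 0 a) x * pd a f (F x).
Proof.
move=> df dF; have dFx := differentiable_rV dF.
rewrite /pd deriveE; last exact: differentiable_comp_rV.
rewrite (@diff_comp _ _ _ _ F f) //= -(@deriveE _ _ _ F) //.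
rewrite derive_rV // [X in 'd f _ X]row_sum_delta linear_sum.
by apply: eq_bigr => a _; rewrite linearZ /= mxE -deriveE.
Qed.

End ChainRule.

(* [smooth_on] quantifies over words of derivatives; its closure properties are
   proved by induction on the order of differentiability instead. *)
Fixpoint Ck (R : realType) n (m : nat) (U : set 'rV[R]_n) (f : 'rV[R]_n -> R) : Prop :=
  (forall x, U x -> differentiable f x) /\
  (if m is m'.+1 then forall i, Ck m' U (pd i f) else True).

(** * Closure properties of smooth functions *)

Section Smooth.
Variables (R : realType) (n : nat) (U : set 'rV[R]_n).
Hypothesis oU : open U.
Implicit Types (f g : 'rV[R]_n -> R).

Lemma smooth_diff f x : smooth_on U f -> U x -> differentiable f x.
Proof. by move=> /(_ [::] x). Qed.

Lemma smooth_pd f i : smooth_on U f -> smooth_on U (pd i f).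
Proof. by move=> sf s x Ux; have := sf (rcons s i) x Ux; rewrite foldr_rcons. Qed.

Lemma smooth_ext f g : (forall z, U z -> f z = g z) ->
  smooth_on U f -> smooth_on U g.
Proof.
move=> fg sf s x Ux; apply: (differentiable_ext oU Ux _ (sf s x Ux)).
elim: s {x Ux} => [|i s IH] z Uz /=; first exact: fg.
exact: pd_ext IH.
Qed.

Lemma CkP f : smooth_on U f <-> forall m, Ck m U f.
Proof.
split.
  move=> + m; elim: m f => [|m IH] f sf; split => //.
  - by move=> x; exact: smooth_diff.
  - by move=> x; exact: smooth_diff.
  - by move=> i; apply: IH; exact: smooth_pd.
(* The last letter of a word is the derivative taken first, so words are taken apart from the
   right. *)
move=> cf s; elim/last_ind: s f cf => [|s i IH] f cf x Ux.
  by have [df _] := cf 0%N; exact: df.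
rewrite foldr_rcons; apply: IH => // m.
by have [_ cf'] := cf m.+1; exact: cf'.
Qed.

Lemma Ck_diff m f x : Ck m U f -> U x -> differentiable f x.
Proof. by case: m => [|m] [df _]; exact: df. Qed.

Lemma CkS m f : Ck m.+1 U f -> Ck m U f.
Proof.
elim: m f => [|m IH] f [df cf]; split => // i.
by apply: IH; exact: cf.
Qed.

Lemma Ck_ext m f g : (forall z, U z -> f z = g z) -> Ck m U f -> Ck m U g.
Proof.
elim: m f g => [|m IH] f g fg [df cf]; split => //.
- by move=> x Ux; exact: differentiable_ext fg (df x Ux).
- by move=> x Ux; exact: differentiable_ext fg (df x Ux).
- by move=> i; apply: IH (cf i) => z Uz; exact: pd_ext fg.
Qed.

Lemma Ck_cst m (c : R) : Ck m U (fun=> c).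
Proof.
elim: m c => [|m IH] c; split => // i.
by apply: Ck_ext (IH 0) => z _; rewrite pd_cst.
Qed.

Lemma CkD m f g : Ck m U f -> Ck m U g -> Ck m U (fun z => f z + g z).
Proof.
elim: m f g => [|m IH] f g [df cf] [dg cg]; split => //.
- by move=> x Ux; apply: differentiableD; [exact: df|exact: dg].
- by move=> x Ux; apply: differentiableD; [exact: df|exact: dg].
- move=> i; apply: (Ck_ext _ (IH _ _ (cf i) (cg i))) => z Uz.
  by rewrite pdD //; [exact: df|exact: dg].
Qed.

Lemma CkM m f g : Ck m U f -> Ck m U g -> Ck m U (fun z => f z * g z).
Proof.
elim: m f g => [|m IH] f g cf cg; split => //.
- by move=> x Ux; apply: differentiableM; [exact: Ck_diff cf Ux|exact: Ck_diff cg Ux].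
- by move=> x Ux; apply: differentiableM; [exact: Ck_diff cf Ux|exact: Ck_diff cg Ux].
- move=> i; have [df cf'] := cf; have [dg cg'] := cg.
  apply: (Ck_ext _ (CkD (IH _ _ (cf' i) (CkS cg)) (IH _ _ (CkS cf) (cg' i)))).
  by move=> z Uz; rewrite pdM //; [exact: df|exact: dg].
Qed.

Lemma CkV m f : (forall z, U z -> f z != 0) -> Ck m U f -> Ck m U (fun z => (f z)^-1).
Proof.
move=> f0; elim: m => [|m IH] cf; split => //.
- by move=> x Ux; apply: differentiableV; [exact: Ck_diff cf Ux|exact: f0].
- by move=> x Ux; apply: differentiableV; [exact: Ck_diff cf Ux|exact: f0].
- move=> i; have [df cf'] := cf; have cV := IH (CkS cf).
  apply: (Ck_ext _ (CkM (Ck_cst _ (-1)) (CkM (CkM cV cV) (cf' i)))) => z Uz.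
  by rewrite pdV ?mulN1r //; [exact: df|exact: f0].
Qed.

Lemma Ck_expR m f : Ck m U f -> Ck m U (fun z => expR (f z)).
Proof.
elim: m => [|m IH] cf; split => //.
- by move=> x Ux; apply: differentiable_expR; exact: Ck_diff cf Ux.
- by move=> x Ux; apply: differentiable_expR; exact: Ck_diff cf Ux.
- move=> i; have [df cf'] := cf.
  apply: (Ck_ext _ (CkM (IH (CkS cf)) (cf' i))) => z Uz.
  by rewrite pd_expR //; exact: df.
Qed.

Lemma smooth_cst (c : R) : smooth_on U (fun=> c).
Proof. by apply/CkP => m; exact: Ck_cst. Qed.

Lemma smoothD f g : smooth_on U f -> smooth_on U g -> smooth_on U (fun z => f z + g z).
Proof. by move=> /CkP cf /CkP cg; apply/CkP => m; exact: CkD. Qed.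

Lemma smoothM f g : smooth_on U f -> smooth_on U g -> smooth_on U (fun z => f z * g z).
Proof. by move=> /CkP cf /CkP cg; apply/CkP => m; exact: CkM. Qed.

Lemma smoothN f : smooth_on U f -> smooth_on U (fun z => - f z).
Proof.
move=> sf; apply: (smooth_ext _ (smoothM (smooth_cst (-1)) sf)) => z _.
by rewrite mulN1r.
Qed.

Lemma smoothB f g : smooth_on U f -> smooth_on U g -> smooth_on U (fun z => f z - g z).
Proof. by move=> sf sg; exact: smoothD sf (smoothN sg). Qed.

Lemma smoothV f : (forall z, U z -> f z != 0) ->
  smooth_on U f -> smooth_on U (fun z => (f z)^-1).
Proof. by move=> f0 /CkP cf; apply/CkP => m; exact: CkV. Qed.

Lemma smooth_expR f : smooth_on U f -> smooth_on U (fun z => expR (f z)).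
Proof. by move=> /CkP cf; apply/CkP => m; exact: Ck_expR. Qed.

Lemma smooth_sum (I : Type) (s : seq I) (P : pred I) (F : I -> 'rV[R]_n -> R) :
  (forall k, P k -> smooth_on U (F k)) ->
  smooth_on U (fun z => \sum_(k <- s | P k) F k z).
Proof.
move=> sF; elim: s => [|a s IH].
  by apply: (smooth_ext _ (smooth_cst 0)) => z _; rewrite big_nil.
case: (boolP (P a)) => Pa.
  by apply: (smooth_ext _ (smoothD (sF a Pa) IH)) => z _; rewrite big_cons Pa.
by apply: (smooth_ext _ IH) => z _; rewrite big_cons (negPf Pa).
Qed.

Lemma smooth_prod (I : Type) (s : seq I) (F : I -> 'rV[R]_n -> R) :
  (forall k, smooth_on U (F k)) -> smooth_on U (fun z => \prod_(k <- s) F k z).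
Proof.
move=> sF; elim: s => [|a s IH].
  by apply: (smooth_ext _ (smooth_cst 1)) => z _; rewrite big_nil.
by apply: (smooth_ext _ (smoothM (sF a) IH)) => z _; rewrite big_cons.
Qed.

Lemma smooth_det m (A : 'rV[R]_n -> 'M[R]_m) :
  (forall i j, smooth_on U (fun z => A z i j)) -> smooth_on U (fun z => \det (A z)).
Proof.
move=> sA; rewrite /determinant; apply: smooth_sum => s _.
by apply: smoothM; [exact: smooth_cst | apply: smooth_prod].
Qed.

(** Cramer's formula: the entries of the inverse are cofactors divided by the determinant, which
    does not vanish on [U]. *)
Lemma smooth_invmx m (A : 'rV[R]_n -> 'M[R]_m) i j :
  (forall z, U z -> A z \in unitmx) ->
  (forall i j, smooth_on U (fun z => A z i j)) ->
  smooth_on U (fun z => invmx (A z) i j).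
Proof.
move=> uA sA; apply: (@smooth_ext (fun z => (\det (A z))^-1 * \adj (A z) i j)).
  by move=> z Uz; rewrite /invmx uA // !mxE.
apply: smoothM.
  by apply: smoothV; [move=> z /uA; rewrite unitmxE unitfE | exact: smooth_det].
apply: (@smooth_ext (fun z => (-1) ^+ (j + i) * \det (row' j (col' i (A z))))).
  by move=> z _; rewrite mxE.
apply: smoothM; first exact: smooth_cst.
by apply: smooth_det => a b; apply: smooth_ext (sA (lift j a) (lift i b)) => z _; rewrite !mxE.
Qed.

Lemma smooth_pd_comm f x i j : U x -> smooth_on U f ->
  pd i (pd j f) x = pd j (pd i f) x.
Proof.
move=> Ux sf; apply: (pd_comm i j oU Ux).
- by move=> z; exact: smooth_diff.
- by move=> a z; apply: smooth_diff; exact: smooth_pd.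
- move=> a b; apply: differentiable_continuous; apply: smooth_diff Ux.
  exact/smooth_pd/smooth_pd.
Qed.

End Smooth.

Section SmoothComp.
Variables (R : realType) (k n : nat).
Variables (U : set 'rV[R]_n) (V : set 'rV[R]_k) (F : 'rV[R]_k -> 'rV[R]_n).
Hypotheses (oU : open U) (oV : open V) (FVU : forall z, V z -> U (F z)).
Hypothesis sF : forall a, smooth_on V (fun z => F z 0 a).

(** The induction is on the order of [f], with [F] smooth throughout: by the chain rule the
    derivatives of the composite involve [f] only through its first derivatives, which have one
    order less. *)
Lemma smooth_comp f : smooth_on U f -> smooth_on V (fun z => f (F z)).
Proof.
move=> sf; apply/CkP => m; have /CkP/(_ m) := sf; move=> {sf}.
have dF z a : V z -> differentiable (fun z => F z 0 a) z.
  exact: smooth_diff.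
elim: m f => [|m IH] f cf; split => //.
- move=> x Vx; apply: differentiable_comp_rV => [|a]; last exact: dF.
  exact: Ck_diff cf (FVU Vx).
- move=> x Vx; apply: differentiable_comp_rV => [|a]; last exact: dF.
  exact: Ck_diff cf (FVU Vx).
- move=> p; have [df cf'] := cf.
  have sCk : forall a, Ck m V (fun z => pd p (fun z => F z 0 a) z * pd a f (F z)).
    move=> a; apply: (CkM oV); last exact: (IH _ (cf' a)).
    by have /CkP H := smooth_pd p (sF a); exact: H.
  apply: (@Ck_ext _ _ _ oV m (fun z => \sum_a pd p (fun z => F z 0 a) z * pd a f (F z))).
    by move=> z Vz; rewrite pd_comp // => [|a]; [exact: df (FVU Vz) | exact: dF].
  elim: (index_enum _) => [|a s IHs].
    by apply: (Ck_ext oV _ (Ck_cst oV m 0)) => z _; rewrite big_nil.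
  by apply: (Ck_ext oV _ (CkD oV (sCk a) IHs)) => z _; rewrite big_cons.
Qed.

End SmoothComp.

(** * The ambient conformal change *)

Section DeltaSums.
Variables (R : pzRingType) (I : finType).
Implicit Types (F : I -> R) (a : I).

Lemma sum_delta a F : \sum_d (a == d)%:R * F d = F a.
Proof.
rewrite (bigD1 a) //= eqxx mul1r big1 ?addr0 // => d da.
by rewrite eq_sym (negPf da) mul0r.
Qed.

Lemma sum_delta' a F : \sum_d (d == a)%:R * F d = F a.
Proof. by under eq_bigr do rewrite eq_sym; exact: sum_delta. Qed.

Lemma sum_deltar a F : \sum_d F d * (a == d)%:R = F a.
Proof.
rewrite (bigD1 a) //= eqxx mulr1 big1 ?addr0 // => d da.
by rewrite eq_sym (negPf da) mulr0.
Qed.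

Lemma sum_deltar' a F : \sum_d F d * (d == a)%:R = F a.
Proof. by under eq_bigr do rewrite eq_sym; exact: sum_deltar. Qed.

Lemma sum_mulrN F G : \sum_d F d * - G d = - \sum_d F d * G d.
Proof. by rewrite -sumrN; apply: eq_bigr => d _; rewrite mulrN. Qed.

End DeltaSums.

(* Gamma_{dab} = g_{de} Gamma^e_{ab} *)
Definition christoffel_low (R : realType) n (g : 'rV[R]_n -> 'M[R]_n)
    (d a b : 'I_n) x : R :=
  \sum_e g x d e * christoffel g e a b x.

Section ConformalDefs.
Variables (R : realType) (n : nat) (g : 'rV[R]_n -> 'M[R]_n) (u : 'rV[R]_n -> R).
Implicit Types (x : 'rV[R]_n) (a b c d e : 'I_n).

Definition conf_metric x : 'M[R]_n := expR (2 * u x) *: g x.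

Definition hess a b x : R := nabla1 g (fun d => pd d u) a b x.

Definition grad c x : R := \sum_d gup g x c d * pd d u x.

Definition gradsq x : R := \sum_d grad d x * pd d u x.

(* The change of Gamma^c_{ab}. *)
Definition christoffel_var c a b x : R :=
  (c == a)%:R * pd b u x + (c == b)%:R * pd a u x - g x a b * grad c x.

(* The change Q_{ab} of the Schouten tensor. *)
Definition schouten_var a b x : R :=
  - hess a b x + pd a u x * pd b u x - 2^-1 * gradsq x * g x a b.

(* Q_a^d (arguments in the order a, d) *)
Definition schouten_var_up a d x : R := \sum_e gup g x d e * schouten_var a e x.

End ConformalDefs.

(* g (d_p, _), d_p the p-th coordinate vector of Y *)
Definition tlow (R : realType) k n (g : 'rV[R]_n -> 'M[R]_n) (f : 'rV[R]_k -> 'rV[R]_n)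
  (p : 'I_k) (b : 'I_n) (y : 'rV[R]_k) : R :=
  \sum_a g (f y) a b * tvec f p a y.

(* Both [ring] and unification unfold these heads when they compare distinct
   atoms, which does not terminate in reasonable time; hence this
   generalization and the opacity directives below. *)
Ltac gen_atoms := repeat match goal with
  | |- context [@christoffel ?R ?n ?g] => generalize (@christoffel R n g); intro
  | |- context [@christoffel_low ?R ?n ?g] => generalize (@christoffel_low R n g); intro
  | |- context [@gup ?R ?n ?g] => generalize (@gup R n g); intro
  | |- context [@riemann ?R ?n ?g] => generalize (@riemann R n g); intro
  | |- context [@riemann_low ?R ?n ?g] => generalize (@riemann_low R n g); intro
  | |- context [@schouten ?R ?n ?g] => generalize (@schouten R n g); intro
  | |- context [@hess ?R ?n ?g ?u] => generalize (@hess R n g u); intro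
  | |- context [@grad ?R ?n ?g ?u] => generalize (@grad R n g u); intro
  | |- context [@weyl ?R ?n ?g] => generalize (@weyl R n g); intro
  | |- context [@cotton ?R ?n ?g] => generalize (@cotton R n g); intro
  | |- context [@nor ?R ?k ?n ?g ?f] => generalize (@nor R k n g f); intro
  | |- context [@hup ?R ?k ?n ?g ?f] => generalize (@hup R k n g f); intro
  | |- context [@first_form ?R ?k ?n ?g ?f] => generalize (@first_form R k n g f); intro
  | |- context [@tvec ?R ?k ?n ?f] => generalize (@tvec R k n f); intro
  | |- context [@tlow ?R ?k ?n ?g ?f] => generalize (@tlow R k n g f); intro
  | |- context [@second_form ?R ?k ?n ?g ?f] => generalize (@second_form R k n g f); intro
  | |- context [@mean_curv ?R ?k ?n ?g ?f] => generalize (@mean_curv R k n g f); intro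
  | |- context [@Lo ?R ?k ?n ?g ?f] => generalize (@Lo R k n g f); intro
  | |- context [@pd ?R ?n] => generalize (@pd R n); intro
  | |- context [@fun_of_matrix ?R ?m ?n] => generalize (@fun_of_matrix R m n); intro
  end.

Ltac gring := gen_atoms; ring.

(** * Curvature tensors of a single metric and their symmetries *)

Section Ambient.
Local Opaque pd.

Variables (R : realType) (n : nat) (U : set 'rV[R]_n) (g : 'rV[R]_n -> 'M[R]_n).
Hypotheses (oU : open U) (sg : forall a b, smooth_on U (fun x => g x a b)).
Hypotheses (gT : forall x, U x -> (g x)^T = g x).
Hypotheses (gu : forall x, U x -> g x \in unitmx).
Implicit Types (x z : 'rV[R]_n) (a b c d e : 'I_n).

Lemma metricC x a b : U x -> g x a b = g x b a.
Proof. by move=> /gT gx; rewrite -{1}gx mxE. Qed.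

Lemma gupC x a b : U x -> gup g x a b = gup g x b a.
Proof. by move=> /gT gx; rewrite /gup -{1}gx -trmx_inv mxE. Qed.

Lemma metric_gup x a b : U x -> \sum_d g x a d * gup g x d b = (a == b)%:R.
Proof. by move=> /gu/mulmxV/matrixP/(_ a b); rewrite !mxE. Qed.

Lemma gup_metric x a b : U x -> \sum_d gup g x a d * g x d b = (a == b)%:R.
Proof. by move=> /gu/mulVmx/matrixP/(_ a b); rewrite !mxE. Qed.

Lemma lower_raise x a (X : 'I_n -> R) : U x ->
  \sum_d g x a d * (\sum_e gup g x d e * X e) = X a.
Proof.
move=> Ux; under eq_bigr do rewrite mulr_sumr.
rewrite exchange_big /= -[RHS](sum_delta a); apply: eq_bigr => e _.
by rewrite -(metric_gup a e Ux) mulr_suml; apply: eq_bigr => d _; rewrite mulrA.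
Qed.

Lemma raise_lower x a (X : 'I_n -> R) : U x ->
  \sum_d gup g x a d * (\sum_e g x d e * X e) = X a.
Proof.
move=> Ux; under eq_bigr do rewrite mulr_sumr.
rewrite exchange_big /= -[RHS](sum_delta a); apply: eq_bigr => e _.
by rewrite -(gup_metric a e Ux) mulr_suml; apply: eq_bigr => d _; rewrite mulrA.
Qed.

Lemma smooth_gup a b : smooth_on U (fun x => gup g x a b).
Proof. exact: smooth_invmx. Qed.

Local Opaque gup.

Lemma smooth_christoffel c a b : smooth_on U (christoffel g c a b).
Proof.
apply: (smoothM oU); first exact: smooth_cst.
apply: smooth_sum => // d _; apply: (smoothM oU); first exact: smooth_gup.
by apply: (smoothB oU); [apply: (smoothD oU)|]; apply: smooth_pd.
Qed.

Lemma pd_metricC a b c x : U x ->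
  pd c (fun z => g z a b) x = pd c (fun z => g z b a) x.
Proof. by move=> Ux; apply: (pd_ext _ oU Ux) => z Uz; exact: metricC. Qed.

Lemma christoffelC c a b x : U x -> christoffel g c a b x = christoffel g c b a x.
Proof.
move=> Ux; rewrite /christoffel; congr (_ * _); apply: eq_bigr => d _.
by rewrite (pd_metricC a b) // (addrC (pd a _ _)).
Qed.

Lemma christoffelE c a b x : christoffel g c a b x = 2^-1 * \sum_d gup g x c d *
  (pd a (fun z => g z b d) x + pd b (fun z => g z a d) x
   - pd d (fun z => g z a b) x).
Proof. by []. Qed.

Local Opaque christoffel.

Lemma christoffel_lowE d a b x : U x -> christoffel_low g d a b x =
  2^-1 * (pd a (fun z => g z b d) x + pd b (fun z => g z a d) x
          - pd d (fun z => g z a b) x).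
Proof.
move=> Ux; rewrite /christoffel_low.
under eq_bigr do rewrite christoffelE mulrCA.
by rewrite -mulr_sumr lower_raise.
Qed.

Lemma christoffel_lowC d a b x : U x -> christoffel_low g d a b x = christoffel_low g d b a x.
Proof. by move=> Ux; apply: eq_bigr => e _; rewrite christoffelC. Qed.

(** This is [nabla g = 0] solved for the partial derivative; derivatives of g are eliminated with it
    from here on. *)
Lemma pd_metric a b c x : U x ->
  pd a (fun z => g z b c) x = christoffel_low g b a c x + christoffel_low g c a b x.
Proof.
move=> Ux; rewrite !christoffel_lowE //.
rewrite (pd_metricC c b) // (pd_metricC a c) // (pd_metricC a b) //.
by field.
Qed.

Lemma riemannE a b c d x : U x -> riemann g a b c d x =
  - pd a (christoffel g d b c) x + pd b (christoffel g d a c) x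
  + \sum_e christoffel g e a c x * christoffel g d b e x
  - \sum_e christoffel g e b c x * christoffel g d a e x.
Proof.
move=> Ux; rewrite /riemann.
set dxd := fun (e : 'I_n) (_ : 'rV[R]_n) => (e == d)%:R : R.
(* The components of [dx^d] are constant, so only the Christoffel term of its covariant derivative
   survives. *)
have n1 : nabla1 g dxd = fun b c z => - christoffel g d b c z.
  apply/funext => p; apply/funext => q; apply/funext => z.
  by rewrite /nabla1 pd_cst sum_deltar' sub0r.
have dC p q : differentiable (christoffel g d p q) x.
  exact: (smooth_diff (smooth_christoffel d p q)).
rewrite n1 /nabla2 !pdN //.
(* Without torsion, the terms that contract the two derivative indices cancel in the commutator. *)
have bA : \sum_e christoffel g e b a x * - christoffel g d e c x =
          \sum_e christoffel g e a b x * - christoffel g d e c x.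
  by apply: eq_bigr => e _; rewrite (christoffelC e b a).
rewrite bA; gen_atoms; rewrite !sum_mulrN; ring.
Qed.

Lemma riemannN a b c d x : riemann g b a c d x = - riemann g a b c d x.
Proof. by symmetry; exact: opprB. Qed.

Lemma smooth_riemann a b c d : smooth_on U (riemann g a b c d).
Proof.
apply: (smooth_ext oU (fun z Uz => esym (riemannE a b c d Uz))).
have sC := smooth_christoffel.
apply: (smoothB oU); first apply: (smoothD oU).
- by apply: (smoothD oU); [apply: (smoothN oU)|]; exact: smooth_pd.
- by apply: smooth_sum => // e _; exact: smoothM.
- by apply: smooth_sum => // e _; exact: smoothM.
Qed.

Local Opaque riemann.

(* The terms quadratic in Gamma, once lowered, are symmetric under the exchange of
   the index pairs, and so are the second derivatives of g. *)
Lemma riemann_lowE a b c d x : U x -> riemann_low g a b c d x =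
  - pd a (christoffel_low g d b c) x + pd b (christoffel_low g d a c) x
  + \sum_e christoffel_low g e a d x * christoffel g e b c x
  - \sum_e christoffel_low g e b d x * christoffel g e a c x.
Proof.
move=> Ux; have dC e p q : differentiable (christoffel g e p q) x.
  exact: (smooth_diff (smooth_christoffel e p q)).
have dg p q : differentiable (fun z => g z p q) x by exact: (smooth_diff (sg p q)).
(* Of the two quadratic terms produced by [pd_metric], the one with [Gamma_dpe] cancels against
   [quad]; the other is the quadratic term of the result. *)
have pdlow p q : pd p (christoffel_low g d q c) x =
    \sum_e g x d e * pd p (christoffel g e q c) x
    + \sum_e christoffel_low g d p e x * christoffel g e q c x
    + \sum_e christoffel_low g e p d x * christoffel g e q c x.
  rewrite pd_sum => [|e _]; last exact: differentiableM.
  rewrite -!big_split /=; apply: eq_bigr => e _.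
  by rewrite pdM // pd_metric //; gring.
have quad p q : \sum_e g x d e * (\sum_f christoffel g f p c x * christoffel g e q f x)
    = \sum_f christoffel_low g d q f x * christoffel g f p c x.
  under eq_bigr do rewrite mulr_sumr.
  rewrite exchange_big /=; apply: eq_bigr => f _.
  by rewrite mulr_suml; apply: eq_bigr => e _; rewrite mulrCA mulrC.
have E1 (A B C D : 'I_n -> R) : \sum_e g x d e * (- A e + B e + C e - D e) =
  - (\sum_e g x d e * A e) + \sum_e g x d e * B e + \sum_e g x d e * C e
  - \sum_e g x d e * D e.
  by rewrite -!sumrN -!big_split /=; apply: eq_bigr => e _; ring.
rewrite (pdlow a b) (pdlow b a) /riemann_low.
under eq_bigr do rewrite riemannE //.
rewrite E1 (quad a b) (quad b a); gring.
Qed.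

Lemma pd_christoffel_low a b c d x : U x -> pd a (christoffel_low g d b c) x =
  2^-1 * (pd a (pd b (fun z => g z c d)) x + pd a (pd c (fun z => g z b d)) x
          - pd a (pd d (fun z => g z b c)) x).
Proof.
move=> Ux; have dg e p q : differentiable (pd e (fun z => g z p q)) x.
  by apply: (smooth_diff (smooth_pd _ (sg p q))).
rewrite (pd_ext a oU Ux (fun z Uz => christoffel_lowE d b c Uz)).
rewrite pdM; [|exact: differentiable_cst|].
  rewrite pd_cst mul0r add0r pdB //; first by rewrite pdD.
  exact: differentiableD.
by apply: differentiableB => //; exact: differentiableD.
Qed.

(** Both sides are [g_ef Gamma^e_ad Gamma^f_bc]: it does not matter which factor is lowered. *)
Lemma christoffel_low_mulC a b c d x : U x ->
  \sum_e christoffel_low g e a d x * christoffel g e b c x =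
  \sum_e christoffel_low g e b c x * christoffel g e a d x.
Proof.
move=> Ux; rewrite /christoffel_low.
under eq_bigr do rewrite mulr_suml.
under [RHS]eq_bigr do rewrite mulr_suml.
rewrite exchange_big /=; apply: eq_bigr => e _; apply: eq_bigr => f _.
by rewrite (metricC f e) //; ring.
Qed.

Local Opaque christoffel_low riemann_low.

Lemma riemann_low_pair a b c d x : U x ->
  riemann_low g a b c d x = riemann_low g c d a b x.
Proof.
move=> Ux; rewrite (riemann_lowE a b c d Ux) (riemann_lowE c d a b Ux).
rewrite (pd_christoffel_low a b c d Ux) (pd_christoffel_low b a c d Ux).
rewrite (pd_christoffel_low c d a b Ux) (pd_christoffel_low d c a b Ux).
have C2 p q r s : pd p (pd q (fun z => g z r s)) x = pd q (pd p (fun z => g z r s)) x.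
  exact: (smooth_pd_comm oU).
have gC2 p q r s : pd p (pd q (fun z => g z r s)) x = pd p (pd q (fun z => g z s r)) x.
  by apply: (pd_ext _ oU Ux) => z Uz; exact: pd_metricC.
have lC p q r s : \sum_e christoffel_low g e p q x * christoffel g e r s x =
              \sum_e christoffel_low g e q p x * christoffel g e s r x.
  by apply: eq_bigr => e _; rewrite christoffel_lowC // (christoffelC e r).
have e1 := etrans (lC c b d a) (christoffel_low_mulC b a d c Ux).
have e2 := lC d b c a.
(* Commuting partial derivatives and the symmetry of g bring the second derivatives on both sides to
   the same form. *)
rewrite (C2 b a c d) (C2 d c a b) (C2 c a d b) (gC2 a c d b) (C2 c b d a) (gC2 b c d a).
rewrite (C2 d a c b) (gC2 a d c b) (C2 d b c a) (gC2 b d c a).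
move: e1 e2; gen_atoms => e1 e2; rewrite e1 e2; ring.
Qed.

(** Antisymmetry in the first pair is built into the commutator; pair symmetry carries it to the
    second pair. *)
Lemma riemann_low_anti a b c d x : U x ->
  riemann_low g a b d c x = - riemann_low g a b c d x.
Proof.
Local Transparent riemann_low.
move=> Ux; rewrite riemann_low_pair // [in RHS]riemann_low_pair //.
rewrite /riemann_low -sumrN; apply: eq_bigr => e _.
by rewrite riemannN mulrN.
Qed.

Lemma riemann_lowN a b c d x : riemann_low g b a c d x = - riemann_low g a b c d x.
Proof. by rewrite /riemann_low -sumrN; apply: eq_bigr => e _; rewrite riemannN mulrN. Qed.

Lemma riemann_gup a b c d x : U x ->
  riemann g a b c d x = \sum_e gup g x d e * riemann_low g a b c e x.
Proof. by move=> Ux; rewrite /riemann_low raise_lower. Qed.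

Local Opaque riemann_low.

(** Ricci is the contraction of the lowered tensor with [gup] over its second and fourth slots, so
    pair symmetry exchanges the two free indices. *)
Lemma ricciC a b x : U x -> ricci g a b x = ricci g b a x.
Proof.
move=> Ux; rewrite /ricci.
under eq_bigr do rewrite riemann_gup //.
under [RHS]eq_bigr do rewrite riemann_gup //.
rewrite exchange_big /=; apply: eq_bigr => c _; apply: eq_bigr => d _.
by rewrite (riemann_low_pair a d b c Ux) (gupC d c Ux).
Qed.

Lemma schoutenC a b x : U x -> schouten g a b x = schouten g b a x.
Proof. by move=> Ux; rewrite /schouten ricciC // (metricC a b). Qed.

Lemma smooth_ricci a b : smooth_on U (ricci g a b).
Proof. by apply: smooth_sum => // c _; exact: smooth_riemann. Qed.

Lemma smooth_schouten a b : smooth_on U (schouten g a b).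
Proof.
apply: (smoothM oU); last exact: smooth_cst.
apply: (smoothB oU); first exact: smooth_ricci.
apply: (smoothM oU); last exact: sg.
apply: (smoothM oU); last exact: smooth_cst.
apply: smooth_sum => // c _; apply: smooth_sum => // d _.
by apply: (smoothM oU); [exact: smooth_gup|exact: smooth_ricci].
Qed.

Lemma smooth_riemann_low a b c d : smooth_on U (riemann_low g a b c d).
Proof.
Local Transparent riemann_low.
by apply: smooth_sum => // e _; apply: (smoothM oU) => //; exact: smooth_riemann.
Qed.

Local Opaque riemann_low.
Local Opaque schouten.

Lemma smooth_weyl a b c d : smooth_on U (weyl g a b c d).
Proof.
have sM p q r s : smooth_on U (fun x => schouten g p q x * g x r s).
  by apply: (smoothM oU) => //; exact: smooth_schouten.
apply: (smoothD oU) => //; apply: (smoothD oU) => //.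
apply: (smoothB oU) => //; apply: (smoothB oU) => //.
exact: smooth_riemann_low.
Qed.

Lemma weyl_pair a b c d x : U x -> weyl g a b c d x = weyl g c d a b x.
Proof.
move=> Ux; rewrite /weyl riemann_low_pair //.
rewrite (schoutenC c a) // (schoutenC d b) // (schoutenC c b) // (schoutenC d a) //.
rewrite (metricC c a) // (metricC d b) // (metricC c b) // (metricC d a) //.
generalize (riemann_low g) (schouten g); intros; gring.
Qed.

Lemma weyl_antil a b c d x : weyl g b a c d x = - weyl g a b c d x.
Proof.
by rewrite /weyl riemann_lowN; generalize (riemann_low g) (schouten g); intros; gring.
Qed.

Lemma weyl_antir a b c d x : U x -> weyl g a b d c x = - weyl g a b c d x.
Proof.
move=> Ux; rewrite /weyl riemann_low_anti //.
by generalize (riemann_low g) (schouten g); intros; gring.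
Qed.

End Ambient.

(** * Conformal change of the connection and of the Riemann tensor *)

Section Conformal.
Local Opaque pd gup christoffel riemann riemann_low schouten nabla1 ricci.

Variables (R : realType) (n : nat) (U : set 'rV[R]_n).
Variables (g : 'rV[R]_n -> 'M[R]_n) (u : 'rV[R]_n -> R).
Hypotheses (oU : open U) (sg : forall a b, smooth_on U (fun x => g x a b)).
Hypotheses (gT : forall x, U x -> (g x)^T = g x).
Hypotheses (gu : forall x, U x -> g x \in unitmx).
Hypothesis su : smooth_on U u.
Implicit Types (x z : 'rV[R]_n) (a b c d e : 'I_n).

Local Notation gh := (conf_metric g u).

Lemma conf_metricE x a b : gh x a b = expR (2 * u x) * g x a b.
Proof. by rewrite mxE. Qed.

Lemma smooth_conf_factor : smooth_on U (fun x => expR (2 * u x)).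
Proof. by apply: smooth_expR => //; apply: smoothM => //; exact: smooth_cst. Qed.

Lemma smooth_conf_metric a b : smooth_on U (fun x => gh x a b).
Proof.
apply: (smooth_ext oU (fun z _ => esym (conf_metricE z a b))).
by apply: smoothM => //; exact: smooth_conf_factor.
Qed.

Lemma conf_metricT x : U x -> (gh x)^T = gh x.
Proof. by move=> /gT gx; rewrite /conf_metric linearZ /= gx. Qed.

Lemma conf_metric_unit x : U x -> gh x \in unitmx.
Proof. by move=> /gu gx; rewrite unitmxZ // unitfE gt_eqF // expR_gt0. Qed.

Lemma gup_conf x a b : U x -> gup gh x a b = expR (- (2 * u x)) * gup g x a b.
Proof.
Local Transparent gup.
move=> /gu gx; rewrite /gup /conf_metric invmxZ //.
  by rewrite mxE expRN.
by rewrite unitmxZ // unitfE gt_eqF // expR_gt0.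
Qed.

Local Opaque gup.

Lemma pd_conf_metric x a b c : U x ->
  pd a (fun z => gh z b c) x =
  expR (2 * u x) * (2 * pd a u x * g x b c + pd a (fun z => g z b c) x).
Proof.
move=> Ux; rewrite (pd_ext a oU Ux (fun z _ => conf_metricE z b c)).
rewrite pdM; [|exact: (smooth_diff smooth_conf_factor)|exact: (smooth_diff (sg b c))].
have du : differentiable u x by exact: (smooth_diff su).
rewrite pd_expR; last by apply: differentiableM => //; exact: differentiable_cst.
rewrite pdM //.
rewrite pd_cst; gring.
Qed.

Lemma christoffel_conf c a b x : U x ->
  christoffel gh c a b x = christoffel g c a b x + christoffel_var g u c a b x.
Proof.
move=> Ux; rewrite !christoffelE.
have E1 d : gup gh x c d * (pd a (fun z => gh z b d) x + pd b (fun z => gh z a d) x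
     - pd d (fun z => gh z a b) x) =
   gup g x c d * (pd a (fun z => g z b d) x + pd b (fun z => g z a d) x
     - pd d (fun z => g z a b) x) + 2 * pd a u x * (gup g x c d * g x d b)
     + 2 * pd b u x * (gup g x c d * g x d a)
     - 2 * g x a b * (gup g x c d * pd d u x).
  rewrite !pd_conf_metric // gup_conf // (metricC gT d b) // (metricC gT d a) //.
  have e0 : expR (- (2 * u x)) * expR (2 * u x) = 1.
    by rewrite -expRD addNr expR0.
  move: e0; gen_atoms; generalize (expR (- (2 * u x))) (expR (2 * u x)) => p q pq.
  rewrite -!(mulrDr q) -mulrBr mulrACA pq mul1r; ring.
under eq_bigr do rewrite E1.
rewrite sumrB !big_split /= -!mulr_sumr !(gup_metric gu _ _ Ux) /christoffel_var.
rewrite -/(grad g u c x); move: (grad g u c x) => w; gen_atoms.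
by field.
Qed.

Let du a x : U x -> differentiable (pd a u) x.
Proof. by move=> Ux; exact: (smooth_diff (smooth_pd a su)). Qed.

Lemma smooth_hess a b : smooth_on U (hess g u a b).
Proof.
Local Transparent nabla1.
apply: (smoothB oU); first by apply/smooth_pd/smooth_pd.
apply: smooth_sum => // d _; apply: smoothM => //; last exact: smooth_pd.
exact: smooth_christoffel.
Qed.

Lemma hessE a b x : hess g u a b x =
  pd a (pd b u) x - \sum_d christoffel g d a b x * pd d u x.
Proof. by []. Qed.

Local Opaque nabla1.

Lemma hessC a b x : U x -> hess g u a b x = hess g u b a x.
Proof.
move=> Ux; rewrite !hessE (smooth_pd_comm oU a b Ux su); congr (_ - _).
by apply: eq_bigr => d _; rewrite (christoffelC oU gT d a b Ux).
Qed.

Lemma smooth_grad c : smooth_on U (grad g u c).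
Proof.
apply: smooth_sum => // d _; apply: smoothM => //; last exact: smooth_pd.
exact: smooth_gup.
Qed.

Lemma smooth_gradsq : smooth_on U (gradsq g u).
Proof.
apply: smooth_sum => // d _; apply: smoothM => //; last exact: smooth_pd.
exact: smooth_grad.
Qed.

Lemma grad_lower x a : U x -> \sum_d g x a d * grad g u d x = pd a u x.
Proof. by move=> Ux; rewrite /grad (lower_raise gu a (fun d => pd d u x) Ux). Qed.

(** This is [nabla_a u^d = g^de nabla_a u_e] in components. It is obtained by differentiating the
    lowered identity [g_fe u^e = u_f] and raising the result, so that the inverse matrix is never
    differentiated. *)
Lemma pd_grad a d x : U x -> pd a (grad g u d) x =
  \sum_e gup g x d e * hess g u a e x - \sum_e christoffel g d a e x * grad g u e x.
Proof.
move=> Ux.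
have dw e : differentiable (grad g u e) x by exact: (smooth_diff (smooth_grad e)).
have dg p q : differentiable (fun z => g z p q) x by exact: (smooth_diff (sg p q)).
have low f : \sum_e g x f e * pd a (grad g u e) x =
    hess g u a f x - \sum_e christoffel_low g f a e x * grad g u e x.
  have E1 : pd a (pd f u) x = \sum_e pd a (fun z => g z f e) x * grad g u e x
      + \sum_e g x f e * pd a (grad g u e) x.
    rewrite -(pd_ext a oU Ux (fun z Uz => grad_lower f Uz)) pd_sum => [|e _].
      by rewrite -big_split /=; apply: eq_bigr => e _; rewrite pdM.
    exact: differentiableM.
  have E2 : \sum_e pd a (fun z => g z f e) x * grad g u e x =
      \sum_e christoffel_low g f a e x * grad g u e x +
      \sum_e christoffel_low g e a f x * grad g u e x.
    rewrite -big_split /=; apply: eq_bigr => e _.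
    by rewrite (pd_metric oU gT gu _ _ _ Ux) mulrDl.
  have E3 : \sum_e christoffel_low g e a f x * grad g u e x =
      \sum_e christoffel g e a f x * pd e u x.
    Local Transparent christoffel_low.
    rewrite /christoffel_low; under eq_bigr do rewrite mulr_suml.
    rewrite exchange_big /=; apply: eq_bigr => e _.
    rewrite -(grad_lower e Ux) mulr_sumr; apply: eq_bigr => h _.
    by rewrite (metricC gT h e Ux); gring.
  rewrite hessE E1 E2 E3; gring.
rewrite -[LHS](raise_lower gu d (fun e => pd a (grad g u e) x) Ux).
under eq_bigr do rewrite low mulrBr.
rewrite sumrB; congr (_ - _).
under eq_bigr do rewrite /christoffel_low.
under [RHS]eq_bigr do rewrite -(raise_lower gu d (fun f => christoffel g f a _ x) Ux) mulr_suml.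
rewrite exchange_big /=; apply: eq_bigr => f _.
by rewrite mulr_sumr; apply: eq_bigr => e _; rewrite mulrA.
Qed.

Local Opaque christoffel_low.

Local Notation B := (christoffel_var g u).

Lemma christoffel_var_suml a c x (X : 'I_n -> R) :
  \sum_e B e a c x * X e =
  pd c u x * X a + pd a u x * X c - g x a c * \sum_e grad g u e x * X e.
Proof.
rewrite -(sum_delta' a (fun e => pd c u x * X e)) -(sum_delta' c (fun e => pd a u x * X e)).
rewrite mulr_sumr -big_split -sumrB /=; apply: eq_bigr => e _.
by rewrite /christoffel_var; gring.
Qed.

Lemma christoffel_var_sumr d b x (X : 'I_n -> R) :
  \sum_e X e * B d b e x =
  (d == b)%:R * (\sum_e X e * pd e u x) + X d * pd b u x
  - grad g u d x * \sum_e g x b e * X e.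
Proof.
rewrite -(sum_delta d (fun e => X e * pd b u x)) !mulr_sumr -big_split -sumrB /=.
by apply: eq_bigr => e _; rewrite /christoffel_var; gring.
Qed.

Lemma pd_christoffel_var a b c d x : U x -> pd a (B d b c) x =
  (d == b)%:R * pd a (pd c u) x + (d == c)%:R * pd a (pd b u) x
  - (pd a (fun z => g z b c) x * grad g u d x + g x b c * pd a (grad g u d) x).
Proof.
move=> Ux; have dw : differentiable (grad g u d) x by exact: (smooth_diff (smooth_grad d)).
have dg p q : differentiable (fun z => g z p q) x by exact: (smooth_diff (sg p q)).
have dcM (r : R) e : differentiable (fun z => r * pd e u z) x.
  by apply: differentiableM; [exact: differentiable_cst|exact: du].
have pdcM (r : R) e : pd a (fun z => r * pd e u z) x = r * pd a (pd e u) x.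
  by rewrite pdM ?pd_cst ?mul0r ?add0r //; exact: du.
rewrite pdB; [|exact: differentiableD|exact: differentiableM].
by rewrite pdD // !pdcM pdM.
Qed.

Lemma smooth_christoffel_var d b c : smooth_on U (B d b c).
Proof.
have scM (r : R) e : smooth_on U (fun z => r * pd e u z).
  by apply: smoothM => //; [exact: smooth_cst|exact: smooth_pd].
apply: smoothB => //; first exact: smoothD.
by apply: smoothM => //; exact: smooth_grad.
Qed.

(** The groups on the right are the products Gamma Gamma, Gamma B, B Gamma and B B, where [B] is the
    change of Gamma. In the last one [u^e B^d_be] collapses to [|du|^2] times the delta, because
    lowering [grad] gives back [du]. *)
Lemma christoffel_quad_conf a b c d x : U x ->
  \sum_e christoffel gh e a c x * christoffel gh d b e x =
  \sum_e christoffel g e a c x * christoffel g d b e x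
  + ((d == b)%:R * (\sum_e christoffel g e a c x * pd e u x)
     + christoffel g d a c x * pd b u x - grad g u d x * christoffel_low g b a c x)
  + (pd c u x * christoffel g d b a x + pd a u x * christoffel g d b c x
     - g x a c * \sum_e christoffel g d b e x * grad g u e x)
  + (pd c u x * B d b a x + pd a u x * B d b c x - g x a c * ((d == b)%:R * gradsq g u x)).
Proof.
Local Transparent christoffel_low.
move=> Ux.
have E1 : \sum_e grad g u e x * B d b e x = (d == b)%:R * gradsq g u x.
  rewrite christoffel_var_sumr grad_lower //; set S := \sum_e _.
  rewrite -[S]/(gradsq g u x); gring.
rewrite /christoffel_low -E1 -christoffel_var_suml.
under [X in g x a c * X]eq_bigr do rewrite mulrC.
rewrite -christoffel_var_suml -christoffel_var_sumr -!big_split /=.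
apply: eq_bigr => e _; rewrite !christoffel_conf //.
by generalize (christoffel_var g u) => B0; gring.
Qed.

Local Opaque christoffel_low.

Lemma schouten_var_upE a d x : U x -> schouten_var_up g u a d x =
  - (\sum_e gup g x d e * hess g u a e x) + pd a u x * grad g u d x
  - 2^-1 * gradsq g u x * (d == a)%:R.
Proof.
move=> Ux; rewrite -(gup_metric gu d a Ux) /schouten_var_up /schouten_var.
move: (gradsq g u x) => n2; rewrite /grad !mulr_sumr.
rewrite -sumrN -big_split -sumrB /=; apply: eq_bigr => e _.
rewrite (metricC gT e a Ux); gring.
Qed.

(** The curvature changes by the antisymmetrized covariant derivative of [B] and by terms quadratic
    in [B]. The former supplies the Hessians in [schouten_var], the latter its two terms quadratic
    in [du]. *)
Lemma riemann_conf a b c d x : U x ->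
  riemann gh a b c d x = riemann g a b c d x
  + (d == b)%:R * schouten_var g u a c x - (d == a)%:R * schouten_var g u b c x
  - g x b c * schouten_var_up g u a d x + g x a c * schouten_var_up g u b d x.
Proof.
move=> Ux.
rewrite (riemannE oU smooth_conf_metric conf_metricT conf_metric_unit a b c d Ux).
rewrite (riemannE oU sg gT gu a b c d Ux) !christoffel_quad_conf //.
have pdch p q : pd p (christoffel gh d q c) x =
    pd p (christoffel g d q c) x + pd p (B d q c) x.
  rewrite (pd_ext p oU Ux (fun z Uz => christoffel_conf d q c Uz)) pdD //.
    by apply: (smooth_diff _ Ux); exact: smooth_christoffel.
  exact: (smooth_diff (smooth_christoffel_var d q c)).
rewrite (pdch a b) (pdch b a) !pd_christoffel_var // !pd_grad // !schouten_var_upE //.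
rewrite !(pd_metric oU gT gu _ _ _ Ux) /schouten_var !hessE /christoffel_var.
rewrite (christoffelC oU gT d b a Ux) (metricC gT b a Ux).
rewrite (christoffel_lowC oU gT c b a Ux) (smooth_pd_comm oU b a Ux su).
set H1 := \sum_e gup g x d e * hess g u a e x.
set H2 := \sum_e gup g x d e * hess g u b e x.
set n2 := gradsq g u x.
clearbody H1 H2 n2; gen_atoms; by field.
Qed.

End Conformal.

(** * Conformal change of the Ricci, Schouten and Weyl tensors *)

Section ConformalCurvature.
Local Opaque pd gup christoffel riemann riemann_low schouten nabla1 ricci.

Variables (R : realType) (n : nat) (U : set 'rV[R]_n).
Variables (g : 'rV[R]_n -> 'M[R]_n) (u : 'rV[R]_n -> R).
Hypotheses (n3 : (3 <= n)%N).
Hypotheses (oU : open U) (sg : forall a b, smooth_on U (fun x => g x a b)).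
Hypotheses (gT : forall x, U x -> (g x)^T = g x).
Hypotheses (gu : forall x, U x -> g x \in unitmx).
Hypothesis su : smooth_on U u.
Implicit Types (x z : 'rV[R]_n) (a b c d e : 'I_n).

Local Notation gh := (conf_metric g u).
Local Notation Q := (schouten_var g u).
Local Notation Qup := (schouten_var_up g u).

Let trQ x := \sum_a Qup a a x.

Let riemann_conf' a b c d x : U x -> riemann gh a b c d x = riemann g a b c d x
  + (d == b)%:R * Q a c x - (d == a)%:R * Q b c x
  - g x b c * Qup a d x + g x a c * Qup b d x.
Proof. exact: riemann_conf. Qed.

Lemma schouten_var_lower a b x : U x -> \sum_c g x b c * Qup a c x = Q a b x.
Proof. by move=> Ux; rewrite /schouten_var_up (lower_raise gu b (fun e => Q a e x) Ux). Qed.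

Local Opaque schouten_var schouten_var_up conf_metric.

(** In the contraction of [riemann_conf] the trace of the delta contributes [n] copies of Q, and two
    of the other terms remove one copy each. *)
Lemma ricci_conf a b x : U x -> ricci gh a b x =
  ricci g a b x + (n%:R - 2) * Q a b x + g x a b * trQ x.
Proof.
Local Transparent ricci.
move=> Ux; rewrite /ricci /trQ.
have E1 c : riemann gh a c b c x = riemann g a c b c x + Q a b x
    - (c == a)%:R * Q c b x - g x b c * Qup a c x + g x a b * Qup c c x.
  by rewrite riemann_conf' // eqxx mul1r (metricC gT c b Ux).
eapply etrans; first by apply: eq_bigr => c _; exact: E1.
rewrite big_split sumrB sumrB big_split /= -mulr_sumr schouten_var_lower //.
rewrite (sum_delta' a (fun c => Q c b x)) sumr_const card_ord -mulr_natl.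
generalize (Q a b x) (\sum_a0 Qup a0 a0 x) => q t; gring.
Qed.

Local Opaque ricci.

Lemma scalar_curv_conf x : U x -> scalar_curv gh x =
  expR (- (2 * u x)) * (scalar_curv g x + (2 * n%:R - 2) * trQ x).
Proof.
Local Transparent schouten_var_up.
move=> Ux; rewrite /scalar_curv.
have trE : \sum_a \sum_b gup g x a b * Q a b x = trQ x by [].
Local Opaque schouten_var_up.
have E0 : \sum_a \sum_b gup g x a b * g x a b = n%:R.
  have -> : n%:R = \sum_(a < n) (1 : R) by rewrite sumr_const card_ord.
  apply: eq_bigr => a _.
  under eq_bigr do rewrite (metricC gT a _ Ux).
  by rewrite (gup_metric gu a a Ux) eqxx.
have E1 a b : gup gh x a b * ricci gh a b x = expR (- (2 * u x)) *
   (gup g x a b * ricci g a b x + (n%:R - 2) * (gup g x a b * Q a b x)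
    + trQ x * (gup g x a b * g x a b)).
  rewrite (gup_conf u gu a b Ux) ricci_conf //.
  by generalize (ricci g) Q (trQ x) (expR (- (2 * u x))); intros; gring.
eapply etrans; first by apply: eq_bigr => a _; apply: eq_bigr => b _; exact: E1.
under eq_bigr do rewrite -mulr_sumr !big_split /= -!mulr_sumr.
rewrite -mulr_sumr !big_split /= -!mulr_sumr E0; congr (_ * _).
rewrite trE; generalize (trQ x) => t; gring.
Qed.

Let n1_neq0 : n%:R - 1 != 0 :> R.
Proof. by rewrite subr_eq0 pnatr_eq1; case: n n3 => [|[|]]. Qed.

Let n2_neq0 : n%:R - 2 != 0 :> R.
Proof. by rewrite subr_eq0 eqr_nat; case: n n3 => [|[|[|]]]. Qed.

(** The scalar curvature gains [(n - 2) + n] traces of Q, which is the normalization [2 (n - 1)] of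
    J. *)
Lemma schoutenJ_conf x : U x -> schoutenJ gh x =
  expR (- (2 * u x)) * (schoutenJ g x + trQ x).
Proof.
move=> Ux; rewrite /schoutenJ scalar_curv_conf //.
generalize (scalar_curv g x) (trQ x) (expR (- (2 * u x))) => s t p.
by have := n1_neq0; generalize (n%:R : R) => m m1; field.
Qed.

(** The multiple of g in [ricci_conf] is absorbed by [J g], whose two conformal factors cancel. What
    is left is [n - 2] times Q, and [n - 2] is nonzero. *)
Lemma schouten_conf a b x : U x -> schouten gh a b x = schouten g a b x + Q a b x.
Proof.
Local Transparent schouten.
move=> Ux; rewrite /schouten ricci_conf // schoutenJ_conf // conf_metricE.
have e0 : expR (- (2 * u x)) * expR (2 * u x) = 1 by rewrite -expRD addNr expR0.
have E1 (t : R) : expR (- (2 * u x)) * t * (expR (2 * u x) * g x a b) = t * g x a b.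
  by rewrite mulrACA e0 mul1r.
rewrite E1; generalize (ricci g a b x) (trQ x) (Q a b x) (schoutenJ g x) (g x a b) => r t q j gab.
by have := n2_neq0; generalize (n%:R : R) => m m1; field.
Qed.

Local Opaque schouten.

Lemma riemann_low_conf a b c d x : U x -> riemann_low gh a b c d x =
  expR (2 * u x) * (riemann_low g a b c d x + g x b d * Q a c x - g x a d * Q b c x
   - g x b c * Q a d x + g x a c * Q b d x).
Proof.
Local Transparent riemann_low.
move=> Ux; rewrite /riemann_low -(schouten_var_lower a d Ux) -(schouten_var_lower b d Ux).
have E1 e : gh x d e * riemann gh a b c e x = expR (2 * u x) *
  (g x d e * riemann g a b c e x + Q a c x * (g x d e * (e == b)%:R)
   - Q b c x * (g x d e * (e == a)%:R) - g x b c * (g x d e * Qup a e x)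
   + g x a c * (g x d e * Qup b e x)).
  rewrite conf_metricE riemann_conf' //.
  by generalize Q Qup (expR (2 * u x)); intros; gring.
eapply etrans; first by apply: eq_bigr => e _; exact: E1.
rewrite -mulr_sumr !(sumrB, big_split) /= -!mulr_sumr.
rewrite !(sum_deltar' _ (fun e => g x d e)) (metricC gT b d Ux) (metricC gT a d Ux).
congr (_ * _); generalize Q Qup; intros; gring.
Qed.

Local Opaque riemann_low.

(** The four Schouten terms of W change by exactly the four Q terms that appear in the lowered
    Riemann tensor. *)
Lemma weyl_conf a b c d x : U x -> weyl gh a b c d x = expR (2 * u x) * weyl g a b c d x.
Proof.
move=> Ux; rewrite /weyl riemann_low_conf // !schouten_conf // !conf_metricE.
generalize Q (expR (2 * u x)); intros; gring.
Qed.

End ConformalCurvature.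

(** * Conformal change of the Cotton tensor *)

Section ConformalCotton.
Local Opaque pd gup christoffel riemann riemann_low schouten nabla1 ricci.

Variables (R : realType) (n : nat) (U : set 'rV[R]_n).
Variables (g : 'rV[R]_n -> 'M[R]_n) (u : 'rV[R]_n -> R).
Hypotheses (n3 : (3 <= n)%N).
Hypotheses (oU : open U) (sg : forall a b, smooth_on U (fun x => g x a b)).
Hypotheses (gT : forall x, U x -> (g x)^T = g x).
Hypotheses (gu : forall x, U x -> g x \in unitmx).
Hypothesis su : smooth_on U u.
Implicit Types (x z : 'rV[R]_n) (a b c d e : 'I_n).
Implicit Types T : 'I_n -> 'I_n -> 'rV[R]_n -> R.

Local Notation gh := (conf_metric g u).
Local Notation Q := (schouten_var g u).

Lemma nabla2_ext (g0 : 'rV[R]_n -> 'M[R]_n) T T' a b c x :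
  (forall p q z, U z -> T p q z = T' p q z) -> U x ->
  nabla2 g0 T a b c x = nabla2 g0 T' a b c x.
Proof.
move=> TT Ux; rewrite /nabla2 (pd_ext a oU Ux (TT b c)).
by congr (_ - _ - _); apply: eq_bigr => d _; rewrite TT.
Qed.

Lemma nabla2D (g0 : 'rV[R]_n -> 'M[R]_n) T T' a b c x :
  differentiable (T b c) x -> differentiable (T' b c) x ->
  nabla2 g0 (fun p q z => T p q z + T' p q z) a b c x =
  nabla2 g0 T a b c x + nabla2 g0 T' a b c x.
Proof.
move=> dT dT'; rewrite /nabla2 pdD //.
have sD (F G H : 'I_n -> R) : \sum_d F d * (G d + H d) = \sum_d F d * G d + \sum_d F d * H d.
  by rewrite -big_split; apply: eq_bigr => d _; rewrite mulrDr.
by gen_atoms; rewrite !sD; ring.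
Qed.

Lemma christoffel_conf_sum a b x (X : 'I_n -> R) : U x ->
  \sum_d christoffel gh d a b x * X d = \sum_d christoffel g d a b x * X d +
  (pd b u x * X a + pd a u x * X b - g x a b * \sum_d grad g u d x * X d).
Proof.
move=> Ux; rewrite -christoffel_var_suml -big_split; apply: eq_bigr => d _.
by rewrite (christoffel_conf oU sg gT gu su d a b Ux) mulrDl.
Qed.

(* Antisymmetrizing in a, b kills the term of Gamma^d_{ab}, and the terms of T_{ab}
   by symmetry of T. *)
Lemma nabla2_conf_anti T a b c x : U x -> (forall p q, T p q x = T q p x) ->
  nabla2 gh T a b c x - nabla2 gh T b a c x =
  nabla2 g T a b c x - nabla2 g T b a c x - pd a u x * T b c x + pd b u x * T a c x
  + g x a c * (\sum_d grad g u d x * T b d x)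
  - g x b c * (\sum_d grad g u d x * T a d x).
Proof.
move=> Ux TC; rewrite /nabla2.
rewrite !(christoffel_conf_sum _ _ (fun d => T d c x) Ux).
rewrite (christoffel_conf_sum _ _ (T b ^~ x) Ux) (christoffel_conf_sum _ _ (T a ^~ x) Ux).
rewrite (TC b a) (metricC gT b a Ux).
have eG : \sum_d christoffel g d b a x * T d c x = \sum_d christoffel g d a b x * T d c x.
  by apply: eq_bigr => d _; rewrite (christoffelC oU gT d b a Ux).
rewrite eG; gring.
Qed.

Let du a x : U x -> differentiable (pd a u) x.
Proof. by move=> Ux; exact: (smooth_diff (smooth_pd a su)). Qed.

Let dh a b x : U x -> differentiable (hess g u a b) x.
Proof. by move=> Ux; apply: (smooth_diff _ Ux); exact: smooth_hess. Qed.

Let dw a x : U x -> differentiable (grad g u a) x.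
Proof. by move=> Ux; apply: (smooth_diff _ Ux); exact: smooth_grad. Qed.

Let dn x : U x -> differentiable (gradsq g u) x.
Proof. by move=> Ux; apply: (smooth_diff _ Ux); exact: smooth_gradsq. Qed.

(** The Christoffel terms of [grad] and of [du] cancel, as [gradsq] is a scalar. The two Hessian
    terms agree, which gives the factor 2. *)
Lemma pd_gradsq a x : U x ->
  pd a (gradsq g u) x = 2 * \sum_d grad g u d x * hess g u a d x.
Proof.
move=> Ux; rewrite /gradsq pd_sum => [|d _]; last first.
  by apply: differentiableM; [exact: dw|exact: du].
have E1 d : pd a (fun z => grad g u d z * pd d u z) x =
    (\sum_e gup g x d e * hess g u a e x) * pd d u x
    - (\sum_e christoffel g d a e x * grad g u e x) * pd d u x
    + (grad g u d x * hess g u a d x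
       + grad g u d x * \sum_e christoffel g e a d x * pd e u x).
  rewrite pdM; [|exact: dw|exact: du].
  rewrite (pd_grad oU sg gT gu su a d Ux) (hessE g u a d); gring.
eapply etrans; first by apply: eq_bigr => d _; exact: E1.
rewrite big_split sumrB big_split /=.
have -> : \sum_d (\sum_e gup g x d e * hess g u a e x) * pd d u x =
          \sum_d grad g u d x * hess g u a d x.
  under eq_bigr do rewrite mulr_suml.
  rewrite exchange_big /=; apply: eq_bigr => e _.
  rewrite /grad mulr_suml; apply: eq_bigr => d _.
  by rewrite (gupC gT d e Ux); gring.
have -> : \sum_d (\sum_e christoffel g d a e x * grad g u e x) * pd d u x =
          \sum_d grad g u d x * (\sum_e christoffel g e a d x * pd e u x).
  under eq_bigr do rewrite mulr_suml.
  rewrite exchange_big /=; apply: eq_bigr => e _.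
  by rewrite mulr_sumr; apply: eq_bigr => d _; gring.
gring.
Qed.

(** Leibniz rule together with [nabla g = 0]; the one half in Q cancels the factor 2 of
    [pd_gradsq]. *)
Lemma nabla2_schouten_var a b c x : U x -> nabla2 g Q a b c x =
  - nabla2 g (hess g u) a b c x + hess g u a b x * pd c u x + pd b u x * hess g u a c x
  - (\sum_d grad g u d x * hess g u a d x) * g x b c.
Proof.
move=> Ux; have dg p q : differentiable (fun z => g z p q) x by exact: (smooth_diff (sg p q)).
have pdQ : pd a (Q b c) x = - pd a (hess g u b c) x
   + (pd a (pd b u) x * pd c u x + pd b u x * pd a (pd c u) x)
   - ((\sum_d grad g u d x * hess g u a d x) * g x b c
      + 2^-1 * gradsq g u x * pd a (fun z => g z b c) x).
  have d1 : differentiable (fun z => pd b u z * pd c u z) x.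
    by apply: differentiableM; exact: du.
  have d2 : differentiable (fun z => 2^-1 * gradsq g u z) x.
    by apply: differentiableM; [exact: differentiable_cst|exact: dn].
  have d3 : differentiable (fun z => - hess g u b c z) x.
    by apply: differentiableN; exact: dh.
  rewrite pdB; [|exact: differentiableD|exact: differentiableM].
  rewrite pdD // pdN; last exact: dh.
  rewrite pdM; [|exact: du|exact: du].
  rewrite pdM // pdM; [|exact: differentiable_cst|exact: dn].
  rewrite pd_cst (pd_gradsq a Ux); move: (gradsq g u x) => n2.
  by set S := \sum_d _; clearbody S; gen_atoms; field.
rewrite /nabla2 pdQ (pd_metric oU gT gu _ _ _ Ux) (hessE g u a b) (hessE g u a c).
have E1 : \sum_d christoffel g d a b x * Q d c x =
  - (\sum_d christoffel g d a b x * hess g u d c x)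
  + pd c u x * (\sum_d christoffel g d a b x * pd d u x)
  - 2^-1 * gradsq g u x * christoffel_low g c a b x.
  rewrite /schouten_var; move: (gradsq g u x) => n2.
  rewrite /christoffel_low !mulr_sumr -sumrN -big_split -sumrB /=.
  by apply: eq_bigr => d _; rewrite (metricC gT d c Ux); gring.
have E2 : \sum_d christoffel g d a c x * Q b d x =
  - (\sum_d christoffel g d a c x * hess g u b d x)
  + pd b u x * (\sum_d christoffel g d a c x * pd d u x)
  - 2^-1 * gradsq g u x * christoffel_low g b a c x.
  rewrite /schouten_var; move: (gradsq g u x) => n2.
  rewrite /christoffel_low !mulr_sumr -sumrN -big_split -sumrB /=.
  by apply: eq_bigr => d _; gring.
rewrite E1 E2; move: (gradsq g u x) => n2; gring.
Qed.

(** The curvature was read off from coordinate one-forms only. For [du] the third derivatives of u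
    cancel, and the derivatives and products of Gamma reassemble into [riemann]. *)
Lemma ricci_identity a b c x : U x ->
  nabla2 g (hess g u) a b c x - nabla2 g (hess g u) b a c x =
  \sum_d riemann g a b c d x * pd d u x.
Proof.
move=> Ux.
have dG e p q : differentiable (christoffel g e p q) x.
  by apply: (smooth_diff _ Ux); exact: smooth_christoffel.
have pdh p q : pd p (hess g u q c) x = pd p (pd q (pd c u)) x
    - (\sum_d pd p (christoffel g d q c) x * pd d u x
       + \sum_d christoffel g d q c x * pd p (pd d u) x).
  have -> : hess g u q c = fun z => pd q (pd c u) z - \sum_d christoffel g d q c z * pd d u z.
    by apply/funext => z; exact: hessE.
  have dM d : differentiable (fun z => christoffel g d q c z * pd d u z) x.
    by apply: differentiableM => //; exact: du.
  rewrite pdB; first last.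
  - apply: (smooth_diff _ Ux); apply: smooth_sum => // d _.
    by apply: smoothM => //; [exact: smooth_christoffel|exact: smooth_pd].
  - by apply: (smooth_diff _ Ux); apply/smooth_pd/smooth_pd.
  rewrite pd_sum // -big_split /=; congr (_ - _); apply: eq_bigr => d _.
  by rewrite pdM //; exact: du.
rewrite /nabla2 (pdh a b) (pdh b a) (smooth_pd_comm oU b a Ux (smooth_pd c su)).
have eG : \sum_d christoffel g d b a x * hess g u d c x =
          \sum_d christoffel g d a b x * hess g u d c x.
  by apply: eq_bigr => d _; rewrite (christoffelC oU gT d b a Ux).
have eh p q : \sum_d christoffel g d p c x * hess g u q d x =
   \sum_d christoffel g d p c x * pd q (pd d u) x
   - \sum_d (\sum_e christoffel g e p c x * christoffel g d q e x) * pd d u x.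
  have -> : \sum_d (\sum_e christoffel g e p c x * christoffel g d q e x) * pd d u x
    = \sum_e christoffel g e p c x * (\sum_d christoffel g d q e x * pd d u x).
    under eq_bigr do rewrite mulr_suml.
    rewrite exchange_big; apply: eq_bigr => e _.
    by rewrite mulr_sumr; apply: eq_bigr => d _; gring.
  rewrite -sumrB; apply: eq_bigr => d _; rewrite hessE; gring.
have -> : \sum_d riemann g a b c d x * pd d u x =
  - (\sum_d pd a (christoffel g d b c) x * pd d u x)
  + \sum_d pd b (christoffel g d a c) x * pd d u x
  + \sum_d (\sum_e christoffel g e a c x * christoffel g d b e x) * pd d u x
  - \sum_d (\sum_e christoffel g e b c x * christoffel g d a e x) * pd d u x.
  rewrite -sumrN -big_split -big_split -sumrB; apply: eq_bigr => d _ /=.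
  by rewrite (riemannE oU sg gT gu a b c d Ux); gring.
by move: eG (eh a b) (eh b a); gen_atoms => eG e1 e2; rewrite eG e1 e2; ring.
Qed.

Lemma weyl_grad a b c x : U x -> \sum_d weyl g a b c d x * grad g u d x =
  \sum_d riemann g a b c d x * pd d u x - schouten g a c x * pd b u x
  - g x a c * (\sum_d grad g u d x * schouten g b d x)
  + g x b c * (\sum_d grad g u d x * schouten g a d x) + schouten g b c x * pd a u x.
Proof.
Local Transparent riemann_low.
move=> Ux.
have -> : \sum_d riemann g a b c d x * pd d u x =
          \sum_d riemann_low g a b c d x * grad g u d x.
  rewrite /riemann_low; under [RHS]eq_bigr do rewrite mulr_suml.
  rewrite exchange_big; apply: eq_bigr => e _ /=.
  rewrite -(grad_lower u gu e Ux) mulr_sumr; apply: eq_bigr => d _.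
  by rewrite (metricC gT d e Ux); gring.
Local Opaque riemann_low.
rewrite -(grad_lower u gu b Ux) -(grad_lower u gu a Ux) !mulr_sumr.
rewrite -sumrB -sumrB -big_split -big_split; apply: eq_bigr => d _ /=.
rewrite /weyl; gring.
Qed.

(** By the Ricci identity the antisymmetrized third derivatives of u give the Riemann tensor
    contracted with [du]. The change of connection acting on the Schouten tensor completes it to the
    Weyl tensor, as in [weyl_grad]; the Hessian and cubic terms cancel. *)
Lemma cotton_conf a b c x : U x -> cotton gh a b c x =
  cotton g a b c x - \sum_d weyl g a b c d x * grad g u d x.
Proof.
move=> Ux.
have dP p q : differentiable (schouten g p q) x.
  by apply: (smooth_diff _ Ux); exact: smooth_schouten.
have dQ p q : differentiable (Q p q) x.
  apply: differentiableB; last first.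
    apply: differentiableM; last exact: (smooth_diff (sg p q)).
    by apply: differentiableM; [exact: differentiable_cst|exact: dn].
  apply: differentiableD; first by apply: differentiableN; exact: dh.
  by apply: differentiableM; exact: du.
have PC p q : schouten g p q x + Q p q x = schouten g q p x + Q q p x.
  rewrite (schoutenC oU sg gT gu p q Ux) /schouten_var (hessC oU gT su p q Ux).
  by rewrite (metricC gT p q Ux); move: (gradsq g u x) => n2; gring.
rewrite /cotton.
have PQ p q z : U z -> schouten gh p q z = schouten g p q z + Q p q z.
  exact: schouten_conf.
rewrite !(nabla2_ext gh _ _ _ PQ Ux).
rewrite (nabla2_conf_anti (T := fun p q z => schouten g p q z + Q p q z) _ _ _ Ux PC).
rewrite !(@nabla2D g (schouten g) Q) // !nabla2_schouten_var // weyl_grad // -ricci_identity //.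
have sQ p : \sum_d grad g u d x * (schouten g p d x + Q p d x) =
  \sum_d grad g u d x * schouten g p d x - \sum_d grad g u d x * hess g u p d x
  + 2^-1 * gradsq g u x * pd p u x.
  (* The coefficient arises as [1 - 1/2]: the product [du du] in Q contributes 1, its trace term
     minus one half. *)
  have -> : 2^-1 * gradsq g u x * pd p u x =
     pd p u x * gradsq g u x - 2^-1 * gradsq g u x * pd p u x.
    by move: (gradsq g u x) => n2; gen_atoms; field.
  rewrite -{2}(grad_lower u gu p Ux); move E : (2^-1 * gradsq g u x) => h.
  rewrite /gradsq !mulr_sumr -sumrB -sumrB -big_split /=; apply: eq_bigr => d _.
  rewrite /schouten_var E; gring.
rewrite !sQ /schouten_var (hessC oU gT su b a Ux).
move: (gradsq g u x) => n2.
set n2a := nabla2 g (hess g u) _ _ _ _; set n2b := nabla2 g (hess g u) _ _ _ _.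
set n2c := nabla2 g (schouten g) _ _ _ _; set n2d := nabla2 g (schouten g) _ _ _ _.
clearbody n2a n2b n2c n2d; gen_atoms; by field.
Qed.

End ConformalCotton.

(** * Immersed submanifolds *)

Section Immersed.
Local Opaque pd gup christoffel riemann riemann_low schouten weyl cotton.

Variables (R : realType) (k n : nat) (U : set 'rV[R]_n) (V : set 'rV[R]_k).
Variables (g : 'rV[R]_n -> 'M[R]_n) (f : 'rV[R]_k -> 'rV[R]_n).
Hypotheses (oU : open U) (sg : forall a b, smooth_on U (fun x => g x a b)).
Hypotheses (gT : forall x, U x -> (g x)^T = g x).
Hypotheses (gu : forall x, U x -> g x \in unitmx).
Hypotheses (oV : open V) (sf : forall a, smooth_on V (fun z => f z 0 a)).
Hypotheses (fU : forall z, V z -> U (f z)).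
Hypotheses (hu : forall z, V z -> first_form g f z \in unitmx).
Implicit Types (y z : 'rV[R]_k) (p q r s : 'I_k) (a b c d e : 'I_n).

Local Notation h := (first_form g f).
Local Notation t := (tvec f).
Local Notation tl := (tlow g f).
Local Notation hi := (hup g f).
Local Notation N := (nor g f).

Lemma first_formE y p q : h y p q = \sum_b tl p b y * t q b y.
Proof.
rewrite mxE exchange_big /=; apply: eq_bigr => b _.
by rewrite /tlow mulr_suml.
Qed.

Lemma first_formT y : V y -> (h y)^T = h y.
Proof.
move=> Vy; apply/matrixP => p q; rewrite !mxE exchange_big /=.
apply: eq_bigr => b _; apply: eq_bigr => a _.
by rewrite (metricC gT a b (fU Vy)); gring.
Qed.

Lemma first_formC y p q : V y -> h y p q = h y q p.
Proof. exact: (metricC first_formT). Qed.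

Lemma hupC y p q : V y -> hi y p q = hi y q p.
Proof. exact: (gupC first_formT). Qed.

Lemma hup_first_form y p q : V y -> \sum_r hi y p r * h y r q = (p == q)%:R.
Proof. exact: (gup_metric hu). Qed.

Lemma tan_coefE X r y : tan_coef g f X r y =
  \sum_q hi y r q * \sum_b tl q b y * X b y.
Proof.
apply: eq_bigr => q _; congr (_ * _); rewrite exchange_big /=.
by apply: eq_bigr => b _; rewrite /tlow mulr_suml.
Qed.

Lemma norE d c y : N d c y = (c == d)%:R - \sum_r (\sum_q hi y r q * tl q d y) * t r c y.
Proof.
rewrite /nor /perp; congr (_ - _); apply: eq_bigr => r _; rewrite tan_coefE.
by congr (_ * _); apply: eq_bigr => q _; rewrite sum_deltar'.
Qed.

(** Projection becomes contraction with the matrix [nor], so that orthogonality arguments reduce to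
    algebra of this matrix. *)
Lemma perpE X c y : perp g f X c y = \sum_d X d y * N d c y.
Proof.
rewrite /perp; under [RHS]eq_bigr do rewrite norE mulrBr.
rewrite sumrB sum_deltar; congr (_ - _).
under [RHS]eq_bigr do rewrite mulr_sumr.
rewrite exchange_big /=; apply: eq_bigr => r _.
rewrite tan_coefE [LHS]mulr_suml.
under [LHS]eq_bigr do rewrite mulr_sumr mulr_suml.
rewrite exchange_big /=; apply: eq_bigr => b _.
by rewrite [in RHS]mulr_suml [in RHS]mulr_sumr; apply: eq_bigr => q _; gring.
Qed.

Local Opaque nor hup.

Lemma tan_coef_tvec p r y : V y -> tan_coef g f (t p) r y = (r == p)%:R.
Proof.
move=> Vy; rewrite tan_coefE -(hup_first_form r p Vy).
by apply: eq_bigr => q _; rewrite first_formE.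
Qed.

Lemma tvec_nor p c y : V y -> \sum_d t p d y * N d c y = 0.
Proof.
move=> Vy; rewrite -perpE /perp.
under eq_bigr do rewrite tan_coef_tvec //.
by rewrite sum_delta' subrr.
Qed.

(** The values of the projector are g-orthogonal to Y. In its other slot it kills tangent vectors,
    which is [tvec_nor]. *)
Lemma tlow_nor p d y : V y -> \sum_c tl p c y * N d c y = 0.
Proof.
move=> Vy; under eq_bigr do rewrite norE mulrBr.
rewrite sumrB sum_deltar'.
under eq_bigr do rewrite mulr_sumr.
rewrite exchange_big /=.
have E1 r : \sum_c tl p c y * ((\sum_q hi y r q * tl q d y) * t r c y) =
   h y p r * (\sum_q hi y r q * tl q d y).
  by rewrite first_formE mulr_suml; apply: eq_bigr => c _; gring.
rewrite (eq_bigr _ (fun r _ => E1 r)).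
by rewrite (lower_raise hu p (fun q => tl q d y) Vy) subrr.
Qed.

Lemma tlowE p b y : V y -> tl p b y = \sum_a g (f y) b a * t p a y.
Proof. by move=> Vy; apply: eq_bigr => a _; rewrite (metricC gT a b (fU Vy)). Qed.

(** Self-adjointness of the orthogonal projection: lowered with g, it is g minus a symmetric
    combination of the covectors [tlow]. *)
Lemma nor_adj c e y : V y -> \sum_d g (f y) c d * N e d y = \sum_d g (f y) e d * N c d y.
Proof.
move=> Vy; have E1 c' e' : \sum_d g (f y) c' d * N e' d y =
    g (f y) c' e' - \sum_r \sum_q hi y r q * (tl q e' y * tl r c' y).
  under eq_bigr do rewrite norE mulrBr.
  rewrite sumrB sum_deltar'; congr (_ - _).
  under eq_bigr do rewrite mulr_sumr.
  rewrite exchange_big /=; apply: eq_bigr => r _.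
  under [RHS]eq_bigr do rewrite mulrA.
  rewrite -mulr_suml tlowE // mulr_sumr; apply: eq_bigr => d _; gring.
rewrite !E1 (metricC gT c e (fU Vy)); congr (_ - _).
rewrite exchange_big /=; apply: eq_bigr => r _; apply: eq_bigr => q _.
by rewrite (hupC q r Vy); gring.
Qed.

Lemma nor_idem c e y : V y -> \sum_d N c d y * N d e y = N c e y.
Proof.
move=> Vy; under eq_bigr do rewrite (norE _ e) mulrBr.
rewrite sumrB sum_deltar; under [X in _ - X]eq_bigr do rewrite mulr_sumr.
rewrite exchange_big /= big1 ?subr0 // => r _.
under eq_bigr do rewrite mulrA mulr_sumr.
rewrite -mulr_suml exchange_big /= big1 ?mul0r // => q _.
rewrite -[RHS](mulr0 (hi y r q)) -[X in _ = _ * X](tlow_nor q c Vy) mulr_sumr.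
by apply: eq_bigr => d _; gring.
Qed.

Lemma smooth_tvec p a : smooth_on V (t p a).
Proof. exact: smooth_pd. Qed.

Lemma smooth_pull (F : 'rV[R]_n -> R) : smooth_on U F -> smooth_on V (fun z => F (f z)).
Proof. exact: smooth_comp. Qed.

Lemma smooth_tlow p b : smooth_on V (tl p b).
Proof.
apply: smooth_sum => // a _; apply: smoothM => //; last exact: smooth_tvec.
exact: (smooth_pull (sg a b)).
Qed.

Lemma smooth_first_form p q : smooth_on V (fun z => h z p q).
Proof.
apply: (smooth_ext oV (fun z _ => esym (first_formE z p q))).
apply: smooth_sum => // b _.
by apply: smoothM => //; [exact: smooth_tlow|exact: smooth_tvec].
Qed.

Lemma smooth_hup p q : smooth_on V (fun z => hi z p q).
Proof. exact: (smooth_gup oV smooth_first_form hu). Qed.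

Lemma smooth_nor d c : smooth_on V (N d c).
Proof.
apply: (smooth_ext oV (fun z _ => esym (norE d c z))).
apply: (smoothB oV); first exact: smooth_cst.
apply: smooth_sum => // r _; apply: smoothM => //; last exact: smooth_tvec.
apply: smooth_sum => // q _; apply: smoothM => //; last exact: smooth_tlow.
exact: smooth_hup.
Qed.

Lemma smooth_perp X c : (forall d, smooth_on V (X d)) -> smooth_on V (perp g f X c).
Proof.
move=> sX; apply: (smooth_ext oV (fun z _ => esym (perpE X c z))).
apply: smooth_sum => // d _; apply: smoothM => //; exact: smooth_nor.
Qed.

Lemma smooth_nabla_pull p X c : (forall d, smooth_on V (X d)) ->
  smooth_on V (nabla_pull g f p X c).
Proof.
move=> sX; apply: smoothD => //; first exact: smooth_pd.
apply: smooth_sum => // a _; apply: smooth_sum => // b _.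
apply: smoothM => //; apply: smoothM => //; last exact: smooth_tvec.
by apply: smooth_pull; exact: smooth_christoffel.
Qed.

Lemma smooth_second_form p q c : smooth_on V (second_form g f p q c).
Proof.
by apply: smooth_perp => d; apply: smooth_nabla_pull => e; exact: smooth_tvec.
Qed.

Lemma smooth_mean_curv c : smooth_on V (mean_curv g f c).
Proof.
apply: smoothM => //; first exact: smooth_cst.
apply: smooth_sum => // p _; apply: smooth_sum => // q _.
by apply: smoothM => //; [exact: smooth_hup|exact: smooth_second_form].
Qed.

Lemma smooth_Lo p q c : smooth_on V (Lo g f p q c).
Proof.
apply: smoothB => //; first exact: smooth_second_form.
by apply: smoothM => //; [exact: smooth_first_form|exact: smooth_mean_curv].
Qed.

Lemma smooth_Lo_up1 p q c : smooth_on V (Lo_up1 g f p q c).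
Proof.
apply: smooth_sum => // s _.
by apply: smoothM => //; [exact: smooth_hup|exact: smooth_Lo].
Qed.

Lemma smooth_Lo_up2 p q c : smooth_on V (Lo_up2 g f p q c).
Proof.
apply: smooth_sum => // s _.
by apply: smoothM => //; [exact: smooth_hup|exact: smooth_Lo_up1].
Qed.

Lemma smooth_weylY p q c r : smooth_on V (weylY g f p q c r).
Proof.
apply: smooth_sum => // a _; apply: smooth_sum => // b _.
apply: smooth_sum => // d _; apply: smooth_sum => // e _.
apply: smoothM => //; last exact: smooth_tvec.
apply: smoothM => //; last exact: smooth_nor.
apply: smoothM => //; last exact: smooth_tvec.
apply: smoothM => //; last exact: smooth_tvec.
by apply: smooth_pull; exact: smooth_weyl.
Qed.

Lemma smooth_weylY_tr p c : smooth_on V (weylY_tr g f p c).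
Proof.
apply: smooth_sum => // q _; apply: smooth_sum => // r _.
by apply: smoothM => //; [exact: smooth_hup|exact: smooth_weylY].
Qed.

(** The second derivatives of the immersion commute and the ambient connection has no torsion. *)
Lemma second_formC p q c y : V y -> second_form g f p q c y = second_form g f q p c y.
Proof.
move=> Vy.
have E d : nabla_pull g f p (t q) d y = nabla_pull g f q (t p) d y.
  rewrite /nabla_pull.
  have -> : pd p (t q d) y = pd q (t p d) y by exact: (smooth_pd_comm oV p q Vy (sf d)).
  rewrite exchange_big /=; apply: (congr1 (fun w => _ + w)).
  apply: eq_bigr => a _; apply: eq_bigr => b _.
  by rewrite (christoffelC oU gT d b a (fU Vy)) mulrAC.
rewrite /second_form (perpE (nabla_pull g f p (t q))) (perpE (nabla_pull g f q (t p))).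
by apply: eq_bigr => d _; rewrite E.
Qed.

Lemma LoC p q c y : V y -> Lo g f p q c y = Lo g f q p c y.
Proof. by move=> Vy; rewrite /Lo second_formC // first_formC. Qed.

Lemma Lo_up2C p q c y : V y -> Lo_up2 g f p q c y = Lo_up2 g f q p c y.
Proof.
move=> Vy; rewrite /Lo_up2 /Lo_up1.
under eq_bigr do rewrite mulr_sumr.
under [RHS]eq_bigr do rewrite mulr_sumr.
rewrite exchange_big /=; apply: eq_bigr => s _; apply: eq_bigr => r _.
by rewrite (LoC r s c Vy) mulrCA.
Qed.

Lemma perp_nor X c y : V y -> \sum_d perp g f X d y * N d c y = perp g f X c y.
Proof.
move=> Vy; under eq_bigr do rewrite perpE mulr_suml.
rewrite exchange_big perpE; apply: eq_bigr => e _ /=.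
by rewrite -(nor_idem e c Vy) mulr_sumr; apply: eq_bigr => d _; rewrite mulrA.
Qed.

Lemma tlow_perp p X y : V y -> \sum_d tl p d y * perp g f X d y = 0.
Proof.
move=> Vy; under eq_bigr do rewrite perpE mulr_sumr.
rewrite exchange_big big1 // => e _ /=.
under eq_bigr do rewrite mulrCA.
by rewrite -mulr_sumr tlow_nor // mulr0.
Qed.

Lemma mean_curv_nor c y : V y -> \sum_d mean_curv g f d y * N d c y = mean_curv g f c y.
Proof.
move=> Vy; rewrite /mean_curv; under eq_bigr do rewrite -mulrA mulr_suml.
rewrite -mulr_sumr exchange_big /=; congr (_ * _); apply: eq_bigr => p _.
under eq_bigr do rewrite mulr_suml.
rewrite exchange_big /=; apply: eq_bigr => q _.
by under eq_bigr do rewrite -mulrA; rewrite -mulr_sumr perp_nor.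
Qed.

Lemma tlow_mean_curv p y : V y -> \sum_d tl p d y * mean_curv g f d y = 0.
Proof.
move=> Vy; under eq_bigr do rewrite -mean_curv_nor // mulr_sumr.
rewrite exchange_big big1 // => e _ /=.
under eq_bigr do rewrite mulrCA.
by rewrite -mulr_sumr tlow_nor // mulr0.
Qed.

(** [tensorD] projects the derivative of H as a vector and then lowers it, but projects the Schouten
    tensor as a covector. Self-adjointness makes the two comparable. *)
Lemma perp_lower X c y : V y ->
  \sum_d g (f y) c d * perp g f X d y = \sum_d (\sum_e g (f y) d e * X e y) * N c d y.
Proof.
move=> Vy; under eq_bigr do rewrite perpE mulr_sumr.
under [RHS]eq_bigr do rewrite mulr_suml.
rewrite exchange_big [RHS]exchange_big /=; apply: eq_bigr => e _.
have E1 (F G : 'I_n -> R) : \sum_d F d * (X e y * G d) = X e y * \sum_d F d * G d.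
  by rewrite mulr_sumr; apply: eq_bigr => d _; rewrite mulrCA.
rewrite E1 nor_adj // mulr_sumr; apply: eq_bigr => d _.
by rewrite (metricC gT d e (fU Vy)); gring.
Qed.

Lemma tan_decomp X c y : X c y = perp g f X c y + \sum_r tan_coef g f X r y * t r c y.
Proof. by rewrite /perp subrK. Qed.

End Immersed.

(** * Conformal change of the fundamental forms *)

Section ConformalImmersed.
Local Opaque pd gup christoffel riemann riemann_low schouten weyl cotton.
Local Opaque conf_metric grad gradsq hess schouten_var nor hup perp nabla_pull
  tan_coef first_form tvec.

Variables (R : realType) (k n : nat) (U : set 'rV[R]_n) (V : set 'rV[R]_k).
Variables (g : 'rV[R]_n -> 'M[R]_n) (f : 'rV[R]_k -> 'rV[R]_n) (u : 'rV[R]_n -> R).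
Hypotheses (k1 : (1 <= k)%N) (n3 : (3 <= n)%N).
Hypotheses (oU : open U) (sg : forall a b, smooth_on U (fun x => g x a b)).
Hypotheses (gT : forall x, U x -> (g x)^T = g x).
Hypotheses (gu : forall x, U x -> g x \in unitmx).
Hypothesis su : smooth_on U u.
Hypotheses (oV : open V) (sf : forall a, smooth_on V (fun z => f z 0 a)).
Hypotheses (fU : forall z, V z -> U (f z)).
Hypotheses (hu : forall z, V z -> first_form g f z \in unitmx).
Implicit Types (y z : 'rV[R]_k) (p q r s : 'I_k) (a b c d e : 'I_n).

Local Notation gh := (conf_metric g u).
Local Notation h := (first_form g f).
Local Notation t := (tvec f).
Local Notation tl := (tlow g f).
Local Notation hi := (hup g f).
Local Notation N := (nor g f).
Local Notation uf := (fun z => u (f z)).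
Local Notation gradY := (grad h uf).

Let expE x : expR (- (2 * u x)) * expR (2 * u x) = 1.
Proof. by rewrite -expRD addNr expR0. Qed.

Lemma pd_uf p y : V y -> pd p uf y = \sum_a t p a y * pd a u (f y).
Proof.
move=> Vy; rewrite pd_comp //; first exact: (smooth_diff su (fU Vy)).
by move=> a; exact: (smooth_diff (sf a)).
Qed.

Lemma first_form_conf y : first_form gh f y = conf_metric h uf y.
Proof.
Local Transparent first_form conf_metric.
apply/matrixP => p q; rewrite !mxE mulr_sumr; apply: eq_bigr => a _.
rewrite mulr_sumr; apply: eq_bigr => b _; rewrite conf_metricE.
by rewrite -!mulrA.
Qed.

Local Opaque first_form conf_metric.

Lemma first_form_confE y p q : first_form gh f y p q = expR (2 * u (f y)) * h y p q.
Proof. by rewrite first_form_conf conf_metricE. Qed.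

Lemma hup_conf y p q : V y -> hup gh f y p q = expR (- (2 * u (f y))) * hi y p q.
Proof.
Local Transparent hup gup.
move=> Vy; rewrite -[hi y]/(gup h y) -(gup_conf uf hu p q Vy).
by rewrite /hup first_form_conf.
Qed.

Local Opaque hup gup.

Lemma tlow_conf p b y : tlow gh f p b y = expR (2 * u (f y)) * tl p b y.
Proof.
rewrite /tlow mulr_sumr; apply: eq_bigr => a _.
by rewrite conf_metricE mulrA.
Qed.

Lemma tan_coef_conf X r y : V y -> tan_coef gh f X r y = tan_coef g f X r y.
Proof.
move=> Vy; rewrite !tan_coefE; apply: eq_bigr => q _.
rewrite hup_conf //; under eq_bigr do rewrite tlow_conf -mulrA.
by rewrite -mulr_sumr mulrACA expE mul1r.
Qed.

Lemma perp_conf X c y : V y -> perp gh f X c y = perp g f X c y.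
Proof.
Local Transparent perp.
move=> Vy; rewrite /perp; apply: (congr1 (fun w => X c y - w)).
by apply: eq_bigr => r _; rewrite tan_coef_conf.
Qed.

Local Opaque perp.

Lemma nor_conf d c y : V y -> nor gh f d c y = N d c y.
Proof.
Local Transparent nor.
exact: perp_conf.
Qed.

Local Opaque nor.

Let w c y := grad g u c (f y).

Lemma tlow_grad p y : V y -> \sum_b tl p b y * w b y = pd p uf y.
Proof.
move=> Vy; rewrite pd_uf // /tlow.
under eq_bigr do rewrite mulr_suml.
rewrite exchange_big /=; apply: eq_bigr => a _.
rewrite -(grad_lower u gu a (fU Vy)) mulr_sumr; apply: eq_bigr => b _.
by rewrite /w; gring.
Qed.

(** By the chain rule [du] on a tangent vector is the differential of the restriction of u. The
    tangential index in the corrections is thus raised intrinsically, with the induced metric, as in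
    the divergence. *)
Lemma tan_coef_grad r y : V y -> tan_coef g f w r y = gradY r y.
Proof.
Local Transparent grad hup gup.
move=> Vy; rewrite tan_coefE /grad; apply: eq_bigr => q _.
by rewrite tlow_grad.
Qed.

Local Opaque grad hup gup.

Lemma nabla_pull_conf p X c y : V y -> nabla_pull gh f p X c y =
  nabla_pull g f p X c y + pd p uf y * X c y
  + (\sum_b pd b u (f y) * X b y) * t p c y
  - (\sum_b tl p b y * X b y) * w c y.
Proof.
Local Transparent nabla_pull.
move=> Vy; rewrite /nabla_pull pd_uf //.
have E1 : \sum_a \sum_b christoffel gh c a b (f y) * t p a y * X b y =
  \sum_a \sum_b christoffel g c a b (f y) * t p a y * X b y
  + \sum_a \sum_b christoffel_var g u c a b (f y) * t p a y * X b y.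
  rewrite -big_split; apply: eq_bigr => a _; rewrite -big_split; apply: eq_bigr => b _ /=.
  by rewrite (christoffel_conf oU sg gT gu su c a b (fU Vy)) mulrDl mulrDl.
rewrite E1 -!addrA; apply: (congr1 (fun w => _ + (_ + w))).
have E2 a : \sum_b christoffel_var g u c a b (f y) * t p a y * X b y =
   (c == a)%:R * t p a y * (\sum_b pd b u (f y) * X b y)
   + t p a y * pd a u (f y) * X c y
   - w c y * (\sum_b g (f y) a b * t p a y * X b y).
  rewrite -(sum_delta c (fun b => t p a y * pd a u (f y) * X b y)) !mulr_sumr.
  rewrite -big_split -sumrB; apply: eq_bigr => b _ /=.
  by rewrite /christoffel_var /w; gring.
eapply etrans; first by apply: eq_bigr => a _; exact: E2.
rewrite sumrB big_split /= -!mulr_suml -mulr_sumr sum_delta.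
have -> : \sum_b tl p b y * X b y = \sum_a \sum_b g (f y) a b * t p a y * X b y.
  rewrite exchange_big /=; apply: eq_bigr => b _.
  by rewrite /tlow mulr_suml.
gring.
Qed.

Local Opaque nabla_pull.

Let nu c y := perp g f w c y.

(** For a coordinate vector of Y, two of the three correction terms in [nabla_pull_conf] are
    tangential and the projection kills them. The third is a multiple of the gradient. *)
Lemma second_form_conf p q c y : V y -> second_form gh f p q c y =
  second_form g f p q c y - h y p q * nu c y.
Proof.
move=> Vy; rewrite /second_form perp_conf // /nu !perpE.
rewrite mulr_sumr -sumrB.
have E1 d : nabla_pull gh f p (t q) d y * N d c y =
    nabla_pull g f p (t q) d y * N d c y - h y p q * (w d y * N d c y)
    + pd p uf y * (t q d y * N d c y)
    + (\sum_b pd b u (f y) * t q b y) * (t p d y * N d c y).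
  rewrite nabla_pull_conf // (first_formE g f y p q).
  generalize (nabla_pull g f p (t q) d y) (w d y) => A3 A4; gring.
eapply etrans; first by apply: eq_bigr => d _; exact: E1.
have S0 r (x : R) : \sum_d x * (t r d y * N d c y) = 0.
  by rewrite -mulr_sumr (tvec_nor hu r c Vy) mulr0.
by rewrite big_split big_split /= !S0 !addr0.
Qed.

Let k_neq0 : k%:R != 0 :> R.
Proof. by rewrite pnatr_eq0 -lt0n. Qed.

Lemma mean_curv_conf c y : V y -> mean_curv gh f c y =
  expR (- (2 * u (f y))) * (mean_curv g f c y - nu c y).
Proof.
move=> Vy.
have E1 p q : hup gh f y p q * second_form gh f p q c y = expR (- (2 * u (f y))) *
   (hi y p q * second_form g f p q c y - nu c y * (hi y p q * h y p q)).
  rewrite hup_conf // second_form_conf //.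
  by move: (expR _) (nu c y) => e0 nu0; gring.
have E2 : \sum_p \sum_q hi y p q * h y p q = k%:R.
  have -> : k%:R = \sum_(a < k) (1 : R) by rewrite sumr_const card_ord.
  apply: eq_bigr => p _; under eq_bigr do rewrite (first_formC gT fU p _ Vy).
  by rewrite (hup_first_form hu p p Vy) eqxx.
have E3 : \sum_p \sum_q hup gh f y p q * second_form gh f p q c y =
   expR (- (2 * u (f y))) * (\sum_p \sum_q hi y p q * second_form g f p q c y - nu c y * k%:R).
  rewrite -E2 [nu c y * _]mulr_sumr -sumrB mulr_sumr; apply: eq_bigr => p _.
  rewrite [nu c y * _]mulr_sumr -sumrB mulr_sumr; apply: eq_bigr => q _.
  exact: E1.
have E4 : mean_curv gh f c y = _ := congr1 ( *%R k%:R^-1) E3.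
have E5 : mean_curv g f c y = k%:R^-1 * \sum_p \sum_q hi y p q * second_form g f p q c y by [].
rewrite E4 E5.
move: (\sum_p _) (expR _) (nu c y) => S e0 nu0.
by have := k_neq0 => k0; field.
Qed.

Local Opaque second_form mean_curv.

(** The change of L is pure trace, and the conformal factors of the first form and of H cancel. *)
Lemma Lo_conf p q c y : V y -> Lo gh f p q c y = Lo g f p q c y.
Proof.
move=> Vy; rewrite /Lo (second_form_conf p q c Vy) (mean_curv_conf c Vy) first_form_confE.
have := expE (f y).
generalize (expR (- (2 * u (f y)))) (expR (2 * u (f y))) (nu c y) => e1 e2 n0 e12.
rewrite (_ : e2 * h y p q * (e1 * (mean_curv g f c y - n0)) =
  e1 * e2 * (h y p q * (mean_curv g f c y - n0))); last by gring.
by rewrite e12; gring.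
Qed.

Local Opaque Lo.

Lemma Lo_up1_conf p q c y : V y ->
  Lo_up1 gh f p q c y = expR (- (2 * u (f y))) * Lo_up1 g f p q c y.
Proof.
move=> Vy; rewrite /Lo_up1 mulr_sumr; apply: eq_bigr => s _.
by rewrite (hup_conf q s Vy) (Lo_conf p s c Vy) mulrA.
Qed.

Local Opaque Lo_up1.

Lemma Lo_up2_conf p q c y : V y -> Lo_up2 gh f p q c y =
  expR (- (2 * u (f y))) * (expR (- (2 * u (f y))) * Lo_up2 g f p q c y).
Proof.
move=> Vy; rewrite /Lo_up2 !mulr_sumr; apply: eq_bigr => s _.
by rewrite (hup_conf p s Vy) (Lo_up1_conf s q c Vy) mulrACA -!mulrA.
Qed.

Lemma weylY_conf p q c r y : V y ->
  weylY gh f p q c r y = expR (2 * u (f y)) * weylY g f p q c r y.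
Proof.
move=> Vy; rewrite /weylY mulr_sumr; apply: eq_bigr => a _.
rewrite mulr_sumr; apply: eq_bigr => b _; rewrite mulr_sumr; apply: eq_bigr => d _.
rewrite mulr_sumr; apply: eq_bigr => e _.
by rewrite (weyl_conf n3 oU sg gT gu su a b d e (fU Vy)) (nor_conf c d Vy) -!mulrA.
Qed.

Local Opaque weylY.

Lemma weylY_tr_conf p c y : V y -> weylY_tr gh f p c y = weylY_tr g f p c y.
Proof.
move=> Vy; rewrite /weylY_tr; apply: eq_bigr => q _; apply: eq_bigr => r _.
by rewrite (hup_conf q r Vy) (weylY_conf p q c r Vy) mulrACA expE mul1r.
Qed.

End ConformalImmersed.

(** * Conformal change of the divergence on Y and of the tensors calC and D *)

Section ConformalScalars.
Local Opaque pd gup christoffel riemann riemann_low schouten weyl cotton.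
Local Opaque conf_metric grad gradsq hess schouten_var nor hup perp nabla_pull
  tan_coef first_form tvec.
Local Opaque second_form mean_curv Lo Lo_up1 Lo_up2 weylY weylY_tr tlow.

Variables (R : realType) (k n : nat) (U : set 'rV[R]_n) (V : set 'rV[R]_k).
Variables (g : 'rV[R]_n -> 'M[R]_n) (f : 'rV[R]_k -> 'rV[R]_n) (u : 'rV[R]_n -> R).
Hypotheses (k1 : (1 <= k)%N) (n3 : (3 <= n)%N).
Hypotheses (oU : open U) (sg : forall a b, smooth_on U (fun x => g x a b)).
Hypotheses (gT : forall x, U x -> (g x)^T = g x).
Hypotheses (gu : forall x, U x -> g x \in unitmx).
Hypothesis su : smooth_on U u.
Hypotheses (oV : open V) (sf : forall a, smooth_on V (fun z => f z 0 a)).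
Hypotheses (fU : forall z, V z -> U (f z)).
Hypotheses (hu : forall z, V z -> first_form g f z \in unitmx).
Implicit Types (y z : 'rV[R]_k) (p q r s : 'I_k) (a b c d e : 'I_n).

Local Notation gh := (conf_metric g u).
Local Notation h := (first_form g f).
Local Notation t := (tvec f).
Local Notation tl := (tlow g f).
Local Notation hi := (hup g f).
Local Notation N := (nor g f).
Local Notation uf := (fun z => u (f z)).
Local Notation gradY := (grad h uf).
Local Notation w := (fun c z => grad g u c (f z)).
Local Notation nu := (perp g f w).
Local Notation ef y := (expR (- (2 * u (f y)))).

Let suf : smooth_on V uf.
Proof. exact: (smooth_comp oV fU sf su). Qed.

Let expE x : expR (- (2 * u x)) * expR (2 * u x) = 1.
Proof. by rewrite -expRD addNr expR0. Qed.

Let tlow_grad' p y : V y -> \sum_b tl p b y * w b y = pd p uf y.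
Proof. exact: (tlow_grad gu su sf fU). Qed.

Lemma pd_conf_weight p (F : 'rV[R]_k -> R) y : V y -> differentiable F y ->
  pd p (fun z => ef z * F z) y = ef y * (pd p F y - 2 * pd p uf y * F y).
Proof.
move=> Vy dF.
have du : differentiable uf y by exact: (smooth_diff suf).
have d2 : differentiable (fun z => 2 * u (f z)) y.
  by apply: differentiableM => //; exact: differentiable_cst.
have d3 : differentiable (fun z => - (2 * u (f z))) y by exact: differentiableN.
rewrite pdM //; last exact: differentiable_expR.
rewrite pd_expR // pdN // pdM //.
rewrite pd_cst; gring.
Qed.

(** The change is that of Christoffel symbols of the induced metric under the restricted factor. It
    is read off by projecting the ambient change, with no need to identify the projected connection
    as Levi-Civita. *)
Lemma nablabar_coef_conf r p q y : V y -> nablabar_coef gh f r p q y =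
  nablabar_coef g f r p q y + christoffel_var h uf r p q y.
Proof.
move=> Vy; rewrite /nablabar_coef (tan_coef_conf u hu _ r Vy) !tan_coefE.
have E1 s : \sum_b tl s b y * nabla_pull gh f p (t q) b y =
   \sum_b tl s b y * nabla_pull g f p (t q) b y + pd p uf y * h y s q
   + pd q uf y * h y s p - h y p q * pd s uf y.
  rewrite -(tlow_grad' s Vy) !first_formE !mulr_sumr -!big_split -sumrB.
  apply: eq_bigr => b _ /=.
  rewrite (nabla_pull_conf oU sg gT gu su sf fU p (t q) b Vy) (pd_uf su sf fU q Vy).
  have -> : \sum_b pd b u (f y) * t q b y = \sum_a t q a y * pd a u (f y).
    by apply: eq_bigr => a _; rewrite mulrC.
  generalize (nabla_pull g f p (t q) b y); intro; gring.
have E2 s : hi y r s * (\sum_b tl s b y * nabla_pull gh f p (t q) b y) =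
   hi y r s * (\sum_b tl s b y * nabla_pull g f p (t q) b y)
   + pd p uf y * (hi y r s * h y s q) + pd q uf y * (hi y r s * h y s p)
   - h y p q * (hi y r s * pd s uf y).
  by rewrite E1; move: (\sum_b _) => S; gring.
eapply etrans; first by apply: eq_bigr => s _; exact: E2.
rewrite sumrB !big_split /= -!mulr_sumr (hup_first_form hu r q Vy) (hup_first_form hu r p Vy).
have -> : \sum_s hi y r s * pd s uf y = gradY r y.
  Local Transparent grad hup gup.
  by [].
Local Opaque grad hup gup.
rewrite /christoffel_var; move: (\sum_s _) => S; gring.
Qed.

(** In [E1] the coefficient 3 is 2 from the weight of [S] plus 1 from the change of connection,
    which also gives the last two terms. Taking the trace yields [- 3 - 1 + k]. *)
Lemma nablabar_div_conf (S Sh : 'I_k -> 'rV[R]_k -> R) y : V y ->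
  (forall q, differentiable (S q) y) ->
  (forall q z, V z -> Sh q z = ef z * S q z) ->
  nablabar_div gh f Sh y =
  ef y * (ef y * (nablabar_div g f S y + (k%:R - 4) * \sum_r gradY r y * S r y)).
Proof.
move=> Vy dS ShE; set X := \sum_r gradY r y * S r y.
have E1 p q : nablabar_cotan gh f Sh p q y = ef y * (nablabar_cotan g f S p q y
    - 3 * (pd p uf y * S q y) - pd q uf y * S p y + h y p q * X).
  rewrite /nablabar_cotan (pd_ext p oV Vy (ShE q)) (pd_conf_weight p Vy (dS q)).
  have E2 : \sum_r nablabar_coef gh f r p q y * Sh r y = ef y *
     (\sum_r nablabar_coef g f r p q y * S r y + (pd q uf y * S p y + pd p uf y * S q y
       - h y p q * X)).
    rewrite -(christoffel_var_suml h uf p q y (S ^~ y)) -big_split mulr_sumr.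
    apply: eq_bigr => r _; rewrite (nablabar_coef_conf r p q Vy) (ShE r y Vy) /=.
    by move: (nablabar_coef _ _ _ _ _ _) (christoffel_var _ _ _ _ _ _) (expR _) => A B C; ring.
  rewrite E2; move: (X) (\sum_r _) (expR _) => X' S' e'; gring.
have E2 p q : hup gh f y p q * nablabar_cotan gh f Sh p q y = ef y * (ef y *
   (hi y p q * nablabar_cotan g f S p q y - 3 * (hi y p q * pd p uf y * S q y)
    - hi y p q * pd q uf y * S p y + X * (hi y p q * h y p q))).
  rewrite (hup_conf u hu p q Vy) E1.
  by move: (X) (nablabar_cotan g f S p q y) (expR _) => X' S' e'; gring.
have G1 : \sum_p \sum_q hi y p q * pd q uf y * S p y = X.
  Local Transparent grad hup gup.
  by apply: eq_bigr => p _; rewrite mulr_suml.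
Local Opaque grad hup gup.
have G2 : \sum_p \sum_q hi y p q * pd p uf y * S q y = X.
  rewrite -G1 exchange_big /=; apply: eq_bigr => p _; apply: eq_bigr => q _.
  by rewrite (hupC gT fU p q Vy).
have G3 : \sum_p \sum_q hi y p q * h y p q = k%:R.
  have -> : k%:R = \sum_(a < k) (1 : R) by rewrite sumr_const card_ord.
  apply: eq_bigr => p _; under eq_bigr do rewrite (first_formC gT fU p _ Vy).
  by rewrite (hup_first_form hu p p Vy) eqxx.
rewrite {1}/nablabar_div.
eapply etrans; first by apply: eq_bigr => p _; apply: eq_bigr => q _; exact: E2.
have lin (A B C D : 'I_k -> 'I_k -> R) (e0 x : R) :
   \sum_p \sum_q e0 * (e0 * (A p q - 3 * B p q - C p q + x * D p q)) =
   e0 * (e0 * (\sum_p \sum_q A p q - 3 * (\sum_p \sum_q B p q) - \sum_p \sum_q C p q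
     + x * \sum_p \sum_q D p q)).
  rewrite !mulr_sumr -!sumrB -!big_split !mulr_sumr /=; apply: eq_bigr => p _.
  by rewrite !mulr_sumr -!sumrB -!big_split !mulr_sumr.
rewrite lin G1 G2 G3 -/(nablabar_div g f S y).
by move: (X) (nablabar_div g f S y) (expR _) => X' D e0; ring.
Qed.

Lemma grad_decomp d y : V y -> w d y = nu d y + \sum_r gradY r y * t r d y.
Proof.
move=> Vy; rewrite [LHS](tan_decomp g f w d y); congr (_ + _); apply: eq_bigr => r _.
by rewrite (tan_coef_grad gu su sf fU r Vy).
Qed.

(** The Cotton tensor loses W contracted with the whole gradient, while subtracting the changed H
    gives back the contraction with its normal part. *)
Lemma calC_conf a b c y : V y -> calC gh f a b c y =
  calC g f a b c y - \sum_r gradY r y * \sum_d weyl g a b c d (f y) * t r d y.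
Proof.
move=> Vy; rewrite /calC (cotton_conf n3 oU sg gT gu su a b c (fU Vy)).
have E1 d : mean_curv gh f d y * weyl gh a b c d (f y) =
   mean_curv g f d y * weyl g a b c d (f y) - weyl g a b c d (f y) * grad g u d (f y)
   + weyl g a b c d (f y) * \sum_r gradY r y * t r d y.
  rewrite (mean_curv_conf k1 oU sg gT gu su sf fU hu d Vy).
  rewrite (weyl_conf n3 oU sg gT gu su a b c d (fU Vy)).
  rewrite [grad g u d (f y)](grad_decomp d Vy) mulrACA expE mul1r.
  by move: (\sum_r _) (perp _ _ _ _ _) => S n0; gring.
have E2 : \sum_d mean_curv gh f d y * weyl gh a b c d (f y) =
  \sum_d mean_curv g f d y * weyl g a b c d (f y) - \sum_d weyl g a b c d (f y) * grad g u d (f y)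
  + \sum_r gradY r y * \sum_d weyl g a b c d (f y) * t r d y.
  eapply etrans; first by apply: eq_bigr => d _; exact: E1.
  rewrite big_split sumrB /=; apply: (congr1 (fun w => _ + w)).
  under eq_bigr do rewrite mulr_sumr.
  under [RHS]eq_bigr do rewrite mulr_sumr.
  rewrite exchange_big /=; apply: eq_bigr => r _; apply: eq_bigr => d _.
  by rewrite mulrCA.
rewrite E2; gring.
Qed.

Let sum_lin (I J : finType) (A : I -> R) (G : J -> R) (B : J -> I -> R) :
  \sum_i (A i - \sum_r G r * B r i) = \sum_i A i - \sum_r G r * \sum_i B r i.
Proof.
rewrite sumrB exchange_big /=; congr (_ - _); apply: eq_bigr => r _.
by rewrite mulr_sumr.
Qed.

Let sum_rev4 (F : 'I_n -> 'I_n -> 'I_n -> 'I_n -> R) :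
  \sum_a \sum_b \sum_d \sum_e F a b d e = \sum_a \sum_b \sum_d \sum_e F e d b a.
Proof.
rewrite exchange_big /=; transitivity (\sum_b \sum_d \sum_e \sum_a F a b d e).
  apply: eq_bigr => b _; rewrite exchange_big /=; apply: eq_bigr => d _.
  exact: exchange_big.
rewrite exchange_big /=; transitivity (\sum_d \sum_e \sum_b \sum_a F a b d e).
  by apply: eq_bigr => d _; exact: exchange_big.
exact: exchange_big.
Qed.

(** [W_pqcr = W_crpq = W_rcqp]: pair symmetry and both antisymmetries move the normal index to the
    second slot, where [calCY] has it. *)
Lemma weylYE p q c r y : V y -> weylY g f p q c r y =
  \sum_a \sum_b \sum_d (\sum_e weyl g a b d e (f y) * t p e y) * t r a y * N c b y * t q d y.
Proof.
Local Transparent weylY.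
move=> Vy; rewrite /weylY sum_rev4.
do 3 (apply: eq_bigr => ? _); rewrite !mulr_suml; apply: eq_bigr => e _.
rewrite (weyl_pair oU sg gT gu _ _ _ _ (fU Vy)) (weyl_antil g).
rewrite (weyl_antir oU sg gT gu _ _ _ _ (fU Vy)) opprK; gring.
Qed.

Local Opaque weylY.

Lemma calCY_conf p c q y : V y -> calCY gh f p c q y =
  calCY g f p c q y - \sum_r gradY r y * weylY g f r q c p y.
Proof.
move=> Vy; have E0 r : gradY r y * weylY g f r q c p y = gradY r y *
   \sum_a \sum_b \sum_d (\sum_e weyl g a b d e (f y) * t r e y) * t p a y * N c b y * t q d y.
  by rewrite (weylYE r q c p Vy).
have -> : \sum_r gradY r y * weylY g f r q c p y = \sum_r gradY r y *
   \sum_a \sum_b \sum_d (\sum_e weyl g a b d e (f y) * t r e y) * t p a y * N c b y * t q d y.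
  by apply: eq_bigr => r _; exact: E0.
rewrite /calCY -sum_lin; apply: eq_bigr => a _.
rewrite -sum_lin; apply: eq_bigr => b _.
rewrite -sum_lin; apply: eq_bigr => d _.
rewrite (calC_conf a b d Vy) (nor_conf u hu c b Vy) !mulrBl !mulr_suml; congr (_ - _).
by apply: eq_bigr => r _; rewrite !mulrA.
Qed.

Lemma nabla_pull_ext p (X Y : 'I_n -> 'rV[R]_k -> R) c y : V y ->
  (forall d z, V z -> X d z = Y d z) ->
  nabla_pull g f p X c y = nabla_pull g f p Y c y.
Proof.
Local Transparent nabla_pull.
move=> Vy XY; rewrite /nabla_pull (pd_ext p oV Vy (XY c)); congr (_ + _).
by apply: eq_bigr => a _; apply: eq_bigr => b _; rewrite XY.
Qed.

Lemma nabla_pull_weight p (X : 'I_n -> 'rV[R]_k -> R) c y : V y ->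
  differentiable (X c) y ->
  nabla_pull g f p (fun d z => ef z * X d z) c y =
  ef y * (nabla_pull g f p X c y - 2 * pd p uf y * X c y).
Proof.
move=> Vy dX; rewrite /nabla_pull (pd_conf_weight p Vy dX).
have -> : \sum_a \sum_b christoffel g c a b (f y) * t p a y * (ef y * X b y) =
   ef y * \sum_a \sum_b christoffel g c a b (f y) * t p a y * X b y.
  rewrite mulr_sumr; apply: eq_bigr => a _; rewrite mulr_sumr; apply: eq_bigr => b _.
  by rewrite mulrCA.
move: (\sum_a _) (expR _) => S e0; gring.
Qed.

Lemma nabla_pullB p (X Y : 'I_n -> 'rV[R]_k -> R) c y :
  differentiable (X c) y -> differentiable (Y c) y ->
  nabla_pull g f p (fun d z => X d z - Y d z) c y =
  nabla_pull g f p X c y - nabla_pull g f p Y c y.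
Proof.
move=> dX dY; rewrite /nabla_pull pdB //.
have -> : \sum_a \sum_b christoffel g c a b (f y) * t p a y * (X b y - Y b y) =
   \sum_a \sum_b christoffel g c a b (f y) * t p a y * X b y
   - \sum_a \sum_b christoffel g c a b (f y) * t p a y * Y b y.
  by do 2 (rewrite -sumrB; apply: eq_bigr => ? _); rewrite mulrBr.
move: (\sum_a \sum_b _ * X _ _) (\sum_a \sum_b _ * Y _ _) => A B; gring.
Qed.

Lemma nabla_pull_comb p (G : 'I_k -> 'rV[R]_k -> R) (X : 'I_k -> 'I_n -> 'rV[R]_k -> R) c y :
  (forall r, differentiable (G r) y) -> (forall r, differentiable (X r c) y) ->
  nabla_pull g f p (fun d z => \sum_r G r z * X r d z) c y =
  \sum_r (pd p (G r) y * X r c y + G r y * nabla_pull g f p (X r) c y).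
Proof.
move=> dG dX; rewrite /nabla_pull pd_sum => [|r _]; last exact: differentiableM.
have -> : \sum_a \sum_b christoffel g c a b (f y) * t p a y * (\sum_r G r y * X r b y) =
  \sum_r G r y * \sum_a \sum_b christoffel g c a b (f y) * t p a y * X r b y.
  under eq_bigr do under eq_bigr do rewrite mulr_sumr.
  under eq_bigr do rewrite exchange_big /=.
  rewrite exchange_big /=; apply: eq_bigr => r _; rewrite mulr_sumr.
  apply: eq_bigr => a _; rewrite mulr_sumr; apply: eq_bigr => b _.
  by rewrite mulrCA.
rewrite -big_split /=; apply: eq_bigr => r _.
by rewrite pdM // mulrDr addrA.
Qed.

Local Opaque nabla_pull.

Lemma nabla_pull_grad p c y : V y -> nabla_pull g f p w c y =
  \sum_a t p a y * \sum_e gup g (f y) c e * hess g u a e (f y).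
Proof.
Local Transparent nabla_pull.
move=> Vy; rewrite /nabla_pull pd_comp; first last.
- by move=> a; exact: (smooth_diff (sf a)).
- by apply: (smooth_diff _ (fU Vy)); exact: smooth_grad.
rewrite -big_split /=; apply: eq_bigr => a _.
rewrite (pd_grad oU sg gT gu su a c (fU Vy)).
have -> : \sum_b christoffel g c a b (f y) * t p a y * grad g u b (f y) =
   t p a y * \sum_b christoffel g c a b (f y) * grad g u b (f y).
  by rewrite mulr_sumr; apply: eq_bigr => b _; gring.
rewrite -[pd p _ y]/(t p a y); gring.
Qed.

Local Opaque nabla_pull.

Let smooth_w d : smooth_on V (w d).
Proof. by apply: (smooth_comp oV fU sf); exact: smooth_grad. Qed.

Let smooth_gradY r : smooth_on V (gradY r).
Proof. exact: (smooth_grad oV (smooth_first_form sg oV sf fU) hu suf). Qed.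

(** The normal gradient is the gradient minus the tangential field [u^r d_r]; the derivative of the
    latter has normal part [u^r L_pr], by the Gauss formula. *)
Lemma perp_nabla_pull_nu p c y : V y ->
  perp g f (nabla_pull g f p nu) c y =
  perp g f (nabla_pull g f p w) c y - \sum_r gradY r y * second_form g f p r c y.
Proof.
Local Transparent second_form.
move=> Vy.
have E1 d : nabla_pull g f p nu d y = nabla_pull g f p w d y -
   \sum_r (pd p (gradY r) y * t r d y + gradY r y * nabla_pull g f p (t r) d y).
  have dG r : differentiable (gradY r) y by apply: (smooth_diff _ Vy); exact: smooth_gradY.
  have dt r : differentiable (t r d) y by apply: (smooth_diff _ Vy); exact: smooth_tvec.
  rewrite -(nabla_pull_comb p dG dt) -nabla_pullB.
  - apply: (nabla_pull_ext p _ Vy) => e z Vz.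
    by rewrite [w e z](grad_decomp e Vz) addrK.
  - by apply: (smooth_diff _ Vy); exact: smooth_w.
  - apply: (smooth_diff _ Vy); apply: smooth_sum => // r _.
    by apply: smoothM => //; exact: smooth_tvec.
rewrite !perpE /second_form.
have E2 d : nabla_pull g f p nu d y * N d c y = nabla_pull g f p w d y * N d c y -
   \sum_r (pd p (gradY r) y * (t r d y * N d c y)
           + gradY r y * (nabla_pull g f p (t r) d y * N d c y)).
  rewrite E1 mulrBl mulr_suml; congr (_ - _); apply: eq_bigr => r _.
  by rewrite mulrDl !mulrA.
eapply etrans; first by apply: eq_bigr => d _; exact: E2.
rewrite sumrB exchange_big /=; congr (_ - _); apply: eq_bigr => r _.
by rewrite big_split /= -!mulr_sumr (tvec_nor hu r c Vy) mulr0 add0r perpE.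
Qed.

Local Opaque second_form.

(** The coefficient of [u_p] is -2 from the factor in [mean_curv_conf] plus 1 from the change of
    connection. The remaining terms are the derivatives of H and of the normal gradient. *)
Lemma nablabar_mean_curv_conf p c y : V y ->
  nablabar_normal gh f p (mean_curv gh f) c y =
  ef y * (nablabar_normal g f p (mean_curv g f) c y
    - perp g f (nabla_pull g f p w) c y + \sum_r gradY r y * second_form g f p r c y
    - pd p uf y * (mean_curv g f c y - nu c y)).
Proof.
move=> Vy; rewrite /nablabar_normal (perp_conf u hu _ c Vy).
have dH d : differentiable (mean_curv g f d) y.
  by apply: (smooth_diff _ Vy); exact: (smooth_mean_curv oU sg gu oV sf fU hu).
have dnu d : differentiable (nu d) y.
  by apply: (smooth_diff _ Vy); apply: (smooth_perp sg oV sf fU hu) => e; exact: smooth_w.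
(* The new H is still normal, so the gradient term of [nabla_pull_conf] vanishes. *)
have tH : \sum_d tl p d y * mean_curv gh f d y = 0.
  have E0 d : tl p d y * mean_curv gh f d y =
      ef y * (tl p d y * mean_curv g f d y - tl p d y * nu d y).
    rewrite (mean_curv_conf k1 oU sg gT gu su sf fU hu d Vy).
    by move: (expR _) (perp _ _ _ _ _) => e0 n0; gring.
  eapply etrans; first by apply: eq_bigr => d _; exact: E0.
  by rewrite -mulr_sumr sumrB (tlow_mean_curv hu p Vy) (tlow_perp hu p w Vy) subrr mulr0.
(* The value of this coefficient does not matter: it multiplies [d_p], which the projection
   kills. *)
pose A := \sum_b pd b u (f y) * mean_curv gh f b y.
have E1 d : nabla_pull gh f p (mean_curv gh f) d y =
   ef y * (nabla_pull g f p (mean_curv g f) d y - nabla_pull g f p nu d y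
           - pd p uf y * (mean_curv g f d y - nu d y)) + A * t p d y.
  have K := nabla_pull_conf oU sg gT gu su sf fU p (mean_curv gh f) d Vy.
  have K1 : nabla_pull g f p (mean_curv gh f) d y =
     nabla_pull g f p (fun d z => ef z * (mean_curv g f d z - nu d z)) d y.
    apply: (nabla_pull_ext p _ Vy) => e z Vz.
    exact: (mean_curv_conf k1 oU sg gT gu su sf fU hu e Vz).
  have K2 := @nabla_pull_weight p (fun d z => mean_curv g f d z - nu d z) d y Vy
    (differentiableB (dH d) (dnu d)).
  have K3 := @nabla_pullB p (mean_curv g f) nu d y (dH d) (dnu d).
  have K4 := mean_curv_conf k1 oU sg gT gu su sf fU hu d Vy.
  move: K; rewrite tH -/A; move: K4 (etrans K1 K2) K3; clear.
  generalize (nabla_pull gh f p (mean_curv gh f) d y) (nabla_pull g f p (mean_curv gh f) d y).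
  generalize (nabla_pull g f p (fun d z => mean_curv g f d z - nu d z) d y).
  generalize (nabla_pull g f p (mean_curv g f) d y) (nabla_pull g f p nu d y).
  generalize A (mean_curv gh f d y) (mean_curv g f d y) (nu d y) (ef y).
  move=> A0 mh m n0 e0 B1 B2 B3 B4 B5 -> -> -> ->; gring.
have E2 d : nabla_pull gh f p (mean_curv gh f) d y * N d c y =
   ef y * (nabla_pull g f p (mean_curv g f) d y * N d c y - nabla_pull g f p nu d y * N d c y
     - pd p uf y * (mean_curv g f d y * N d c y - nu d y * N d c y))
   + A * (t p d y * N d c y).
  rewrite E1.
  generalize (nabla_pull g f p (mean_curv g f) d y) (nabla_pull g f p nu d y).
  move: (A) (nu d y) (expR _) => A0 n0 e0 B0 C0; gring.
eapply etrans; first exact: perpE.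
eapply etrans; first by apply: eq_bigr => d _; exact: E2.
rewrite big_split /= -!mulr_sumr !sumrB -!mulr_sumr !sumrB.
rewrite (tvec_nor hu p c Vy) mulr0 addr0 (mean_curv_nor hu c Vy) (perp_nor hu w c Vy).
rewrite -!perpE (perp_nabla_pull_nu p c Vy).
move: (perp g f (nabla_pull g f p (mean_curv g f)) c y) (perp g f (nabla_pull g f p w) c y).
move: (nu c y) (expR _) (\sum_r _) => n0 e0 S A0 B0; gring.
Qed.

(** The mixed Hessian and the products of [u_p] with the normal part of [du] occur in both terms of
    D and cancel. There remains [u^r L_prc - u_p H_c], which is [u^r Lo_prc] because
    [u_p = u^r h_pr]. *)
Lemma tensorD_conf p c y : V y -> tensorD gh f p c y =
  tensorD g f p c y - \sum_r gradY r y * \sum_d g (f y) c d * Lo g f p r d y.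
Proof.
Local Transparent Lo tlow.
move=> Vy; rewrite /tensorD.
(* [nc] is the normal part of [du], [Hc] is H lowered, [HN] is the tangential-normal Hessian, and
   [LL] is [u^r L_prc]. *)
pose nc := \sum_b pd b u (f y) * N c b y.
pose Hc := \sum_d g (f y) c d * mean_curv g f d y.
pose HN := \sum_a \sum_b hess g u a b (f y) * t p a y * N c b y.
pose LL := \sum_r gradY r y * \sum_d g (f y) c d * second_form g f p r d y.
have E1 : \sum_a \sum_b schouten gh a b (f y) * t p a y * nor gh f c b y =
   \sum_a \sum_b schouten g a b (f y) * t p a y * N c b y - HN + pd p uf y * nc.
  have E0 a b : schouten gh a b (f y) * t p a y * nor gh f c b y =
     schouten g a b (f y) * t p a y * N c b y - hess g u a b (f y) * t p a y * N c b y
     + t p a y * pd a u (f y) * (pd b u (f y) * N c b y)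
     - 2^-1 * gradsq g u (f y) * (g (f y) a b * t p a y * N c b y).
    rewrite (schouten_conf n3 oU sg gT gu su a b (fU Vy)) (nor_conf u hu c b Vy).
    Local Transparent schouten_var.
    rewrite /schouten_var; move: (gradsq _ _ _) => n2; gring.
  Local Opaque schouten_var.
  (* The metric has no tangential-normal components, so the term of Q proportional to g drops
     out. *)
  have gN : \sum_a \sum_b g (f y) a b * t p a y * N c b y = 0.
    rewrite -[RHS](tlow_nor hu p c Vy) exchange_big /=; apply: eq_bigr => b _.
    by rewrite /tlow mulr_suml.
  have lin (A B C D : 'I_n -> 'I_n -> R) (x : R) :
     \sum_a \sum_b (A a b - B a b + C a b - x * D a b) =
     \sum_a \sum_b A a b - \sum_a \sum_b B a b + \sum_a \sum_b C a b - x * \sum_a \sum_b D a b.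
    rewrite mulr_sumr -sumrB -big_split -sumrB; apply: eq_bigr => a _ /=.
    by rewrite mulr_sumr -sumrB -big_split -sumrB.
  eapply etrans; first by apply: eq_bigr => a _; apply: eq_bigr => b _; exact: E0.
  rewrite lin gN mulr0 subr0; congr (_ + _).
  rewrite (pd_uf su sf fU p Vy) mulr_suml; apply: eq_bigr => a _.
  by rewrite mulr_sumr.
have E2 : \sum_d gh (f y) c d * nablabar_normal gh f p (mean_curv gh f) d y =
   \sum_d g (f y) c d * nablabar_normal g f p (mean_curv g f) d y - HN + LL
   - pd p uf y * (Hc - nc).
  have E0 d : gh (f y) c d * nablabar_normal gh f p (mean_curv gh f) d y =
      g (f y) c d * nablabar_normal g f p (mean_curv g f) d y
      - g (f y) c d * perp g f (nabla_pull g f p w) d y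
      + (\sum_r gradY r y * (g (f y) c d * second_form g f p r d y))
      - pd p uf y * (g (f y) c d * mean_curv g f d y - g (f y) c d * nu d y).
    rewrite conf_metricE (nablabar_mean_curv_conf p d Vy).
    have -> : \sum_r gradY r y * (g (f y) c d * second_form g f p r d y) =
       g (f y) c d * \sum_r gradY r y * second_form g f p r d y.
      by rewrite mulr_sumr; apply: eq_bigr => r _; rewrite mulrCA.
    have := expE (f y).
    generalize (nablabar_normal g f p (mean_curv g f) d y)
      (perp g f (nabla_pull g f p w) d y) (nu d y).
    generalize (expR (- (2 * u (f y)))) (expR (2 * u (f y))) => e1 e2 A B C e12.
    move: (\sum_r _) => S.
    have key (x x' : R) : e2 * x * (e1 * x') = x * x'.
      by rewrite mulrACA (mulrC e2) e12 mul1r.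
    by rewrite key; gring.
  eapply etrans; first by apply: eq_bigr => d _; exact: E0.
  rewrite sumrB big_split sumrB /= -mulr_sumr sumrB; congr (_ - _ + _ - _ * (_ - _)).
  - rewrite (perp_lower gT fU _ c Vy).
    have E3 d : (\sum_e g (f y) d e * nabla_pull g f p w e y) * N c d y =
       \sum_a hess g u a d (f y) * t p a y * N c d y.
      rewrite -mulr_suml; congr (_ * _).
      under eq_bigr do rewrite (nabla_pull_grad p _ Vy) mulr_sumr.
      rewrite exchange_big /=; apply: eq_bigr => a _.
      under eq_bigr do rewrite mulrCA.
      by rewrite -mulr_sumr (lower_raise gu d (fun e => hess g u a e (f y)) (fU Vy)) mulrC.
    eapply etrans; first by apply: eq_bigr => d _; exact: E3.
    exact: exchange_big.
  - rewrite exchange_big /=; apply: eq_bigr => r _.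
    by rewrite mulr_sumr.
  - rewrite (perp_lower gT fU w c Vy); apply: eq_bigr => d _.
    by rewrite (grad_lower u gu d (fU Vy)).
have E3 : \sum_r gradY r y * \sum_d g (f y) c d * Lo g f p r d y = LL - pd p uf y * Hc.
  rewrite -(grad_lower uf hu p Vy) mulr_suml -sumrB; apply: eq_bigr => r _.
  have -> : \sum_d g (f y) c d * Lo g f p r d y =
     \sum_d g (f y) c d * second_form g f p r d y - h y p r * Hc.
    rewrite mulr_sumr -sumrB; apply: eq_bigr => d _; rewrite /Lo; gring.
  move: (\sum_d _ * second_form _ _ _ _ _ _) (Hc) => S0 H0; gring.
have fin (S1 S2 x x1 x2 x3 x4 : R) :
    S1 - x1 + x * x2 - (S2 - x1 + x4 - x * (x3 - x2)) = S1 - S2 - (x4 - x * x3) by ring.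
apply: etrans (congr2 (fun x x' => x - x') E1 E2) _.
apply: etrans (fin _ _ _ _ _ _ _) _.
exact: (congr1 (fun x => _ - x) (esym E3)).
Qed.

Local Opaque Lo tlow.

End ConformalScalars.

(** * The two scalars in coordinates *)

Section ConformalInvariants.
Local Opaque pd gup christoffel riemann riemann_low schouten weyl cotton.
Local Opaque conf_metric grad gradsq hess schouten_var nor hup perp nabla_pull
  tan_coef first_form tvec.
Local Opaque second_form mean_curv Lo Lo_up1 Lo_up2 weylY weylY_tr tlow.

Variables (R : realType) (k n : nat) (U : set 'rV[R]_n) (V : set 'rV[R]_k).
Variables (g : 'rV[R]_n -> 'M[R]_n) (f : 'rV[R]_k -> 'rV[R]_n) (u : 'rV[R]_n -> R).
Hypotheses (k1 : (1 <= k)%N) (n3 : (3 <= n)%N).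
Hypotheses (oU : open U) (sg : forall a b, smooth_on U (fun x => g x a b)).
Hypotheses (gT : forall x, U x -> (g x)^T = g x).
Hypotheses (gu : forall x, U x -> g x \in unitmx).
Hypothesis su : smooth_on U u.
Hypotheses (oV : open V) (sf : forall a, smooth_on V (fun z => f z 0 a)).
Hypotheses (fU : forall z, V z -> U (f z)).
Hypotheses (hu : forall z, V z -> first_form g f z \in unitmx).
Implicit Types (y z : 'rV[R]_k) (p q r s : 'I_k) (a b c d e : 'I_n).

Local Notation gh := (conf_metric g u).
Local Notation hi := (hup g f).
Local Notation uf := (fun z => u (f z)).
Local Notation gradY := (grad (first_form g f) uf).
Local Notation ef y := (expR (- (2 * u (f y)))).

Let expE x : expR (- (2 * u x)) * expR (2 * u x) = 1.
Proof. by rewrite -expRD addNr expR0. Qed.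

Let sum_lin (I J : finType) (A : I -> R) (G : J -> R) (B : J -> I -> R) :
  \sum_i (A i - \sum_r G r * B r i) = \sum_i A i - \sum_r G r * \sum_i B r i.
Proof.
rewrite sumrB exchange_big /=; congr (_ - _); apply: eq_bigr => r _.
by rewrite mulr_sumr.
Qed.

(** Two raised indices of Lo contribute [e^(-4u)] and W contributes [e^(2u)], which is the weight
    required by [nablabar_div_conf]. *)
Lemma K1_conf y : V y -> K1 gh f y = ef y * (ef y * K1 g f y).
Proof.
move=> Vy; rewrite /K1.
pose S p z := \sum_q \sum_r \sum_c Lo_up2 g f q r c z * weylY g f p q c r z.
have dS p : differentiable (S p) y.
  apply: (smooth_diff _ Vy); apply: smooth_sum => // q _; apply: smooth_sum => // r _.
  apply: smooth_sum => // c _; apply: smoothM => //.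
    exact: (smooth_Lo_up2 oU sg gu oV sf fU hu).
  exact: (smooth_weylY oU sg gT gu oV sf fU hu).
have ShE p z : V z ->
    \sum_q \sum_r \sum_c Lo_up2 gh f q r c z * weylY gh f p q c r z = ef z * S p z.
  move=> Vz; rewrite /S; do 3 (rewrite mulr_sumr; apply: eq_bigr => ? _).
  rewrite (Lo_up2_conf k1 oU sg gT gu su sf fU hu _ _ _ Vz).
  rewrite (weylY_conf n3 oU sg gT gu su fU hu _ _ _ _ Vz).
  by rewrite -(mulrA (ef z)) [ef z * _ * _]mulrACA expE mul1r.
have D := nablabar_div_conf oU sg gT gu su oV sf fU hu Vy dS ShE.
(* The correction of [calCY], contracted with Lo, is [S] after the two indices of Lo are
   exchanged. *)
have SE r : \sum_p \sum_q \sum_c Lo_up2 g f p q c y * weylY g f r q c p y = S r y.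
  rewrite exchange_big /=; apply: eq_bigr => q _; apply: eq_bigr => p _.
  apply: eq_bigr => c _.
  by rewrite (Lo_up2C oU gT oV sf fU p q c Vy).
have T : \sum_p \sum_q \sum_c Lo_up2 gh f p q c y * calCY gh f p c q y =
   ef y * (ef y * (\sum_p \sum_q \sum_c Lo_up2 g f p q c y * calCY g f p c q y
                   - \sum_r gradY r y * S r y)).
  have -> : \sum_r gradY r y * S r y =
    \sum_r gradY r y * \sum_p \sum_q \sum_c Lo_up2 g f p q c y * weylY g f r q c p y.
    by apply: eq_bigr => r _; rewrite SE.
  rewrite -sum_lin !mulr_sumr; apply: eq_bigr => p _.
  rewrite -sum_lin !mulr_sumr; apply: eq_bigr => q _.
  rewrite -sum_lin !mulr_sumr; apply: eq_bigr => c _.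
  rewrite (Lo_up2_conf k1 oU sg gT gu su sf fU hu p q c Vy).
  rewrite (calCY_conf k1 n3 oU sg gT gu su sf fU hu p c q Vy).
  have -> : \sum_r gradY r y * (Lo_up2 g f p q c y * weylY g f r q c p y) =
     Lo_up2 g f p q c y * \sum_r gradY r y * weylY g f r q c p y.
    by rewrite mulr_sumr; apply: eq_bigr => r _; rewrite mulrCA.
  by rewrite -mulrBr !mulrA.
apply: etrans (congr2 (fun x x' => x + (k%:R - 4) * x') D T) _.
have fin (x x1 x2 x3 m : R) : x * (x * (x1 + m * x3)) + m * (x * (x * (x2 - x3))) =
  x * (x * (x1 + m * x2)) by ring.
exact: fin.
Qed.

(** Here the factor of [S] comes from the single raised index of Lo: the trace of W over Y is
    invariant. *)
Lemma K2_conf y : V y -> K2 gh f y = ef y * (ef y * K2 g f y).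
Proof.
move=> Vy; rewrite /K2.
pose S p z := \sum_q \sum_c Lo_up1 g f p q c z * weylY_tr g f q c z.
have dS p : differentiable (S p) y.
  apply: (smooth_diff _ Vy); apply: smooth_sum => // q _.
  apply: smooth_sum => // c _; apply: smoothM => //.
    exact: (smooth_Lo_up1 oU sg gu oV sf fU hu).
  exact: (smooth_weylY_tr oU sg gT gu oV sf fU hu).
have ShE p z : V z ->
    \sum_q \sum_c Lo_up1 gh f p q c z * weylY_tr gh f q c z = ef z * S p z.
  move=> Vz; rewrite /S; do 2 (rewrite mulr_sumr; apply: eq_bigr => ? _).
  rewrite (Lo_up1_conf k1 oU sg gT gu su sf fU hu _ _ _ Vz).
  by rewrite (weylY_tr_conf n3 oU sg gT gu su fU hu _ _ Vz) mulrA.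
have D := nablabar_div_conf oU sg gT gu su oV sf fU hu Vy dS ShE.
(* [M] is the correction of D contracted as in K2. Its [gup] undoes the lowering of the normal index
   of Lo, and the symmetries of Lo and [hup] turn it into [S]. *)
pose M r p q c d := hi y p q * gup g (f y) c d
  * (\sum_e g (f y) c e * Lo g f p r e y) * weylY_tr g f q d y.
have SE r : \sum_p \sum_q \sum_c \sum_d M r p q c d = S r y.
  Local Transparent Lo_up1.
  have E1 p q : \sum_c \sum_d M r p q c d =
      \sum_d hi y p q * Lo g f p r d y * weylY_tr g f q d y.
    rewrite exchange_big /=; apply: eq_bigr => d _; rewrite -mulr_suml; congr (_ * _).
    under eq_bigr do rewrite -mulrA (gupC gT _ d (fU Vy)).
    by rewrite -mulr_sumr (raise_lower gu d (fun e => Lo g f p r e y) (fU Vy)).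
  eapply etrans; first by apply: eq_bigr => p _; apply: eq_bigr => q _; exact: E1.
  rewrite exchange_big /=; apply: eq_bigr => q _.
  rewrite exchange_big /=; apply: eq_bigr => c _; rewrite -mulr_suml; congr (_ * _).
  apply: eq_bigr => p _.
  by rewrite (hupC gT fU p q Vy) (LoC oU gT oV sf fU p r c Vy).
have T : \sum_p \sum_q \sum_c \sum_d hup gh f y p q * gup gh (f y) c d
      * tensorD gh f p c y * weylY_tr gh f q d y =
   ef y * (ef y * (\sum_p \sum_q \sum_c \sum_d
      hi y p q * gup g (f y) c d * tensorD g f p c y * weylY_tr g f q d y
                   - \sum_r gradY r y * S r y)).
  have -> : \sum_r gradY r y * S r y =
    \sum_r gradY r y * \sum_p \sum_q \sum_c \sum_d M r p q c d.
    by apply: eq_bigr => r _; rewrite SE.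
  rewrite -sum_lin !mulr_sumr; apply: eq_bigr => p _.
  rewrite -sum_lin !mulr_sumr; apply: eq_bigr => q _.
  rewrite -sum_lin !mulr_sumr; apply: eq_bigr => c _.
  rewrite -sum_lin !mulr_sumr; apply: eq_bigr => d _.
  rewrite (hup_conf u hu p q Vy) (gup_conf u gu c d (fU Vy)).
  rewrite (tensorD_conf k1 n3 oU sg gT gu su oV sf fU hu p c Vy).
  rewrite (weylY_tr_conf n3 oU sg gT gu su fU hu q d Vy).
  have -> : \sum_r gradY r y * M r p q c d =
     hi y p q * gup g (f y) c d * (\sum_r gradY r y * \sum_e g (f y) c e * Lo g f p r e y)
     * weylY_tr g f q d y.
    rewrite mulr_sumr mulr_suml; apply: eq_bigr => r _; rewrite /M.
    move: (\sum_e _) (gup _ _ _ _) (weylY_tr _ _ _ _ _) => x1 x2 x3; gring.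
  move: (\sum_r _) (gup _ _ _ _) (weylY_tr _ _ _ _ _) (tensorD _ _ _ _ _) (expR _).
  by move=> x1 x2 x3 x4 x5; gring.
apply: etrans (congr2 (fun x x' => x + (k%:R - 4) * x') D T) _.
have fin (x x1 x2 x3 m : R) : x * (x * (x1 + m * x3)) + m * (x * (x * (x2 - x3))) =
  x * (x * (x1 + m * x2)) by ring.
exact: fin.
Qed.

End ConformalInvariants.

(** A nonzero kernel vector would make the quadratic form vanish. *)
Lemma posdef_unitmx (R : realType) m (A : 'M[R]_m) :
  (forall v : 'rV[R]_m, v != 0 -> 0 < (v *m A *m v^T) 0 0) -> A \in unitmx.
Proof.
move=> Apos; rewrite -row_free_unit -kermx_eq0; apply/negPn/negP => /rowV0Pn[v].
by move=> /sub_kermxP vA /Apos; rewrite vA mul0mx mxE ltxx.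
Qed.

(** * Passing to charts *)

Section Charts.
Variables (R : realType) (k n : nat) (Y : manifold R k) (X : manifold R n).
Variables (i : Y -> X) (g : metric_field X) (Ups : X -> R).
Hypotheses (i_imm : immersion i) (gR : riemannian g) (sUps : smooth_fun Ups).
Variables (p : Y) (cY : chart R Y k) (cX : chart R X n).
Hypotheses (aY : atlas cY) (aX : atlas cX) (pY : chart_dom cY p) (pX : chart_dom cX (i p)).

Let V := chart_img cY `&` (i \o chart_inv cY) @^-1` chart_dom cX.
Let f := coord_rep i cY cX.
Let u := Ups \o chart_inv cX.

Let oU : open (chart_img cX).
Proof. by have [] := manifold_charts aX. Qed.

Let oV : open V.
Proof.
have [_ oiY _ cinv _] := manifold_charts aY.
have [oX _ _ _ _] := manifold_charts aX.
have [[ci _] _] := i_imm.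
rewrite openE => z [Iz Dz]; apply: filterI; first exact: open_nbhs_nbhs.
have : {for z, continuous (i \o chart_inv cY)}.
  apply: continuous_comp; last exact: ci.
  (* Continuity within the image of the chart is continuity at [z], since this image is open. *)
  by move: cinv; rewrite continuous_open_subspace // => /(_ z); apply; rewrite inE.
by apply; exact: open_nbhs_nbhs.
Qed.

Let sf a : smooth_on V (fun z => f z 0 a).
Proof. by have [[_ sm] _] := i_imm; exact: (sm cY cX aY aX a). Qed.

Let fU z : V z -> chart_img cX (f z).
Proof. by case=> _ Dz; exists (i (chart_inv cY z)). Qed.

Let sg a b : smooth_on (chart_img cX) (fun x => g cX x a b).
Proof. by have [+ _] := gR aX. Qed.

Let gT x : chart_img cX x -> (g cX x)^T = g cX x.
Proof. by have [_ +] := gR aX => /[apply] -[]. Qed.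

Let gpos x (v : 'rV[R]_n) : chart_img cX x -> v != 0 -> 0 < (v *m g cX x *m v^T) 0 0.
Proof. by have [_ +] := gR aX => /[apply] -[_ + _]; apply. Qed.

Let gu x : chart_img cX x -> g cX x \in unitmx.
Proof. by move=> Ux; apply: posdef_unitmx => v; exact: gpos. Qed.

Let hu z : V z -> first_form (g cX) f z \in unitmx.
Proof.
move=> Vz; have [[q Dq qz] Dz] := Vz.
have [_ _ _ _ inv] := manifold_charts aY.
have ez : chart_inv cY z = q by rewrite -qz inv.
have free : row_free ('J f z).
  by have [_ fr] := i_imm; rewrite -qz; apply: fr => //; rewrite -ez.
(* The first form is the Gram matrix of the rows of the Jacobian; these are independent for an
   immersion, so it inherits positivity from g. *)
have hE : first_form (g cX) f z = 'J f z *m g cX (f z) *m ('J f z)^T.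
  have df a : differentiable (fun z => f z 0 a) z by exact: (smooth_diff (sf a)).
  have : forall r a, 'J f z r a = tvec f r a z by move=> r a; exact: jacobian_pd.
  move: ('J f z) => J JE; apply/matrixP => r s.
  rewrite !mxE exchange_big /=; apply: eq_bigr => b _.
  rewrite !mxE JE mulr_suml; apply: eq_bigr => a _.
  by rewrite JE [_ * g cX _ _ _]mulrC.
apply: posdef_unitmx => v v0; rewrite hE !mulmxA -mulmxA -trmx_mul.
by apply: gpos; [exact: fU | rewrite mulmx_free_eq0].
Qed.

Let Vp : V (cY p).
Proof.
have [_ _ _ _ inv] := manifold_charts aY.
by split; [exists p | rewrite /= inv].
Qed.

Let up : u (f (cY p)) = Ups (i p).
Proof.
have [_ _ _ _ invY] := manifold_charts aY; have [_ _ _ _ invX] := manifold_charts aX.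
by rewrite /u /f /coord_rep /= invY // invX.
Qed.

Let weight : expR (- 4 * Ups (i p)) =
  expR (- (2 * u (f (cY p)))) * expR (- (2 * u (f (cY p)))).
Proof. by rewrite -expRD up; congr expR; ring. Qed.

Lemma scalar_at_K1_conf : (1 <= k)%N -> (3 <= n)%N ->
  scalar_at (@K1 R k n) i (conformal_change Ups g) cY cX p =
  expR (- 4 * Ups (i p)) * scalar_at (@K1 R k n) i g cY cX p.
Proof.
move=> k1 n3; rewrite weight -mulrA.
exact: (K1_conf k1 n3 oU sg gT gu (sUps aX) oV sf fU hu Vp).
Qed.

Lemma scalar_at_K2_conf : (1 <= k)%N -> (3 <= n)%N ->
  scalar_at (@K2 R k n) i (conformal_change Ups g) cY cX p =
  expR (- 4 * Ups (i p)) * scalar_at (@K2 R k n) i g cY cX p.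
Proof.
move=> k1 n3; rewrite weight -mulrA.
exact: (K2_conf k1 n3 oU sg gT gu (sUps aX) oV sf fU hu Vp).
Qed.

End Charts.

Theorem proposition5p2 (R : realType) (k n : nat)
    (hk : (1 <= k)%N) (hkn : (k < n)%N) (hn : (3 <= n)%N) :
  conformally_invariant (@K1 R k n) (- 4) /\
  conformally_invariant (@K2 R k n) (- 4).
Proof.
split=> Y X i g Ups i_imm gR sUps p cY cX aY aX pY pX.
- exact: scalar_at_K1_conf.
- exact: scalar_at_K2_conf.
Qed.
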